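(* Let $k$ be an algebraically closed field of characteristic $p$ and let $d\geq p\geq 5$ and $m,n\geq d$. Then the Schur superalgebra $S(m|n,d)$ has infinite global dimension.
   Context: Let $V$ be a superspace with basis $v_1,\dots,v_{m+n}$, where $v_1,\dots,v_m$ are even and $v_{m+1},\dots,v_{m+n}$ are odd ($\bar v_i$ the parity). $\Sigma_d$ acts on the right on $V^{\otimes d}$ by $(\dots\otimes v_{i_j}\otimes v_{i_{j+1}}\otimes\dots)\cdot(j\ j{+}1)=(-1)^{\bar v_{i_j}\bar v_{i_{j+1}}}(\dots\otimes v_{i_{j+1}}\otimes v_{i_j}\otimes\dots)$. The Schur superalgebra is $S(m|n,d)=\operatorname{End}_{k\Sigma_d}(V^{\otimes d})$. *)

(* Defs.v *)
From HB Require Import structures.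
From mathcomp Require Import all_boot all_order all_fingroup all_algebra.
Set Implicit Arguments. Unset Strict Implicit. Unset Printing Implicit Defensive.
Import GRing.Theory.
Local Open Scope ring_scope.

(* Basis of V^{(x)d}: words x : 'I_d -> 'I_(m+n); e_x = v_{x 0} (x) ... (x) v_{x (d-1)}.
   Index i : 'I_(m+n) is odd iff m <= i (v_1..v_m even, v_{m+1}..v_{m+n} odd). *)
Definition sword (m n d : nat) := {ffun 'I_d -> 'I_(m + n)}.
Definition sdim (m n d : nat) : nat := #|{: sword m n d}|.

Definition odd_idx (m n : nat) (i : 'I_(m + n)) : bool := (m <= i)%N.

(* Matrix (row-vector convention, v |-> v *m M) of the right action of the
   transposition (j k) on V^{(x)d}, with the super sign rule:
   e_x . (j k) = (-1)^{|x_j||x_k|} e_{x o (j k)}.  Used for k = j+1. *)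
Definition gen_mx (F : fieldType) (m n d : nat) (j k : 'I_d) : 'M[F]_(sdim m n d) :=
  \matrix_(a, b)
    (let x := (enum_val a : sword m n d) in
     if enum_val b == [ffun t => x (tperm j k t)] :> sword m n d
     then (-1) ^+ (odd_idx (x j) && odd_idx (x k)) else 0).

(* The Schur superalgebra S(m|n,d) = End_{k Sigma_d}(V^{(x)d}), as the set of
   matrices commuting with the action of the Coxeter generators (j j+1). *)
Definition inSchur (F : fieldType) (m n d : nat) (A : 'M[F]_(sdim m n d)) : Prop :=
  forall j k : 'I_d, nat_of_ord k = (nat_of_ord j).+1 ->
    A *m @gen_mx F m n d j k = @gen_mx F m n d j k *m A.

Section Modules.
Variables (F : fieldType) (m n d : nat).
Local Notation N := (sdim m n d).
Local Notation S := (@inSchur F m n d).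

(* A finite-dimensional right S-module of dimension r: the action of A in S on
   row vectors is v |-> v *m rho A. *)
Definition is_smodule (r : nat) (rho : 'M[F]_N -> 'M[F]_r) : Prop :=
  [/\ forall A B, S A -> S B -> rho (A *m B) = rho A *m rho B,
      forall (c : F) A B, S A -> S B -> rho (c *: A + B) = c *: rho A + rho B
    & rho 1%:M = 1%:M].

Definition is_shom (r1 r2 : nat) (rho1 : 'M[F]_N -> 'M[F]_r1)
    (rho2 : 'M[F]_N -> 'M[F]_r2) (f : 'M[F]_(r1, r2)) : Prop :=
  forall A, S A -> rho1 A *m f = f *m rho2 A.

Definition is_sproj (r : nat) (rho : 'M[F]_N -> 'M[F]_r) : Prop :=
  forall (r1 r2 : nat) (rho1 : 'M[F]_N -> 'M[F]_r1) (rho2 : 'M[F]_N -> 'M[F]_r2)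
         (g : 'M[F]_(r1, r2)) (f : 'M[F]_(r, r2)),
    is_smodule rho1 -> is_smodule rho2 -> is_shom rho1 rho2 g -> row_full g ->
    is_shom rho rho2 f ->
    exists h : 'M[F]_(r, r1), is_shom rho rho1 h /\ h *m g = f.

(* pd M <= len : there is a projective resolution
   0 -> P_len -> ... -> P_1 -> P_0 -> M -> 0, with differentials
   d0 : P_0 -> M and dd i : P_(i+1) -> P_i. *)
Definition pd_le (len : nat) (rM : nat) (rhoM : 'M[F]_N -> 'M[F]_rM) : Prop :=
  exists (r : nat -> nat) (rho : forall i, 'M[F]_N -> 'M[F]_(r i))
         (d0 : 'M[F]_(r 0%N, rM)) (dd : forall i, 'M[F]_(r i.+1, r i)),
    [/\ (forall i, (i <= len)%N -> is_smodule (rho i) /\ is_sproj (rho i)),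
        (is_shom (rho 0%N) rhoM d0 /\ row_full d0),
        (forall i, (i < len)%N -> is_shom (rho i.+1) (rho i) (dd i)),
        (if len is 0 then row_free d0 else (dd 0%N == kermx d0)%MS) &
        ((forall i, (i.+1 < len)%N -> (dd i.+1 == kermx (dd i))%MS) /\
         (if len is len'.+1 then row_free (dd len') else True))].

End Modules.

Definition schur_gldim_infinite (F : fieldType) (m n d : nat) : Prop :=
  forall len : nat, exists (r : nat) (rho : 'M[F]_(sdim m n d) -> 'M[F]_r),
    is_smodule rho /\ ~ pd_le len rho.

(* Main.v *)
Require Import Defs.
From HB Require Import structures.
From mathcomp Require Import all_boot all_order all_fingroup all_algebra.
From mathcomp Require Import zify ring.
Import GRing.Theory.

(** Let h = (p-1)/2, W = V^{(x)d} and c the p-cycle on the first p places; let E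
    be the group of even permutations of those places that fix the first one and
    normalize <c>.  By Zolotarev's lemma E acts on F_p through the squares, so
    that the quadratic Gauss sum Y = sum_k k^h c^k commutes with E, and Y^2 is
    up to sign the norm of <c>.  Put P = W^E and Z = W^<E,c>.

    Modulo words that are constant on the first p places, on which <c> acts
    trivially, W is free over k<c>, a truncated polynomial ring in which Y
    generates the h-th power of the radical.  This makes
      D (v, w) = (v Y + w, - (v Y + w) Y)
    an endomorphism of Q = P + Z with kernel equal to its image.

    Q is projective: e_x S is projective for every word x, which gives W and the
    invariants and anti-invariants of Sym_p in W; and as <c> fixes exactly the
    points of E among the cosets <c>\Alt_p, the transfer shows that Z is a
    summand of W plus these two.  It is here that odd letters are needed.

    If im D had a finite projective resolution, comparing it with the periodic
    one would give an S-map K with D = D K D, so that q - q D K would lie in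
    ker D = im D for all q in Q.  But the image of an S-map W -> Z has no
    component on the constant words, hence neither would the second component
    of any q in Q; the words whose first p letters are all v_1 refute this. *)

Set Implicit Arguments.
Unset Strict Implicit.
Unset Printing Implicit Defensive.

Local Open Scope ring_scope.

(** * Modules over the Schur superalgebra *)

Section ModuleTheory.
Variables (F : fieldType) (m n d : nat).
Local Notation N := (sdim m n d).
Local Notation S := (@inSchur F m n d).
Local Notation rep r := ('M[F]_N -> 'M[F]_r).

Lemma inSchur1 : S 1%:M.
Proof. by move=> j k _; rewrite mul1mx mulmx1. Qed.

Lemma inSchurM A B : S A -> S B -> S (A *m B).
Proof. by move=> SA SB j k jk; rewrite -mulmxA SB // mulmxA SA // mulmxA. Qed.

Lemma inSchurZD c A B : S A -> S B -> S (c *: A + B).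
Proof.
by move=> SA SB j k jk; rewrite mulmxDl mulmxDr -scalemxAl -scalemxAr SA ?SB.
Qed.

Lemma shomM r1 r2 r3 (rho1 : rep r1) (rho2 : rep r2) (rho3 : rep r3)
    (f : 'M_(r1, r2)) (g : 'M_(r2, r3)) :
  is_shom rho1 rho2 f -> is_shom rho2 rho3 g -> is_shom rho1 rho3 (f *m g).
Proof. by move=> Hf Hg A SA; rewrite mulmxA Hf // -mulmxA Hg // mulmxA. Qed.

Lemma shomD r1 r2 (rho1 : rep r1) (rho2 : rep r2) (f g : 'M_(r1, r2)) :
  is_shom rho1 rho2 f -> is_shom rho1 rho2 g -> is_shom rho1 rho2 (f + g).
Proof. by move=> Hf Hg A SA; rewrite mulmxDl mulmxDr Hf ?Hg. Qed.

Lemma shomZ r1 r2 (rho1 : rep r1) (rho2 : rep r2) c (f : 'M_(r1, r2)) :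
  is_shom rho1 rho2 f -> is_shom rho1 rho2 (c *: f).
Proof. by move=> Hf A SA; rewrite -scalemxAl -scalemxAr Hf. Qed.

Lemma shomB r1 r2 (rho1 : rep r1) (rho2 : rep r2) (f g : 'M_(r1, r2)) :
  is_shom rho1 rho2 f -> is_shom rho1 rho2 g -> is_shom rho1 rho2 (f - g).
Proof. by move=> Hf Hg A SA; rewrite mulmxBl mulmxBr Hf ?Hg. Qed.

Lemma shom0 r1 r2 (rho1 : rep r1) (rho2 : rep r2) :
  is_shom rho1 rho2 (0 : 'M_(r1, r2)).
Proof. by move=> A SA; rewrite mul0mx mulmx0. Qed.

Lemma shom1 r (rho : rep r) : is_shom rho rho 1%:M.
Proof. by move=> A SA; rewrite mul1mx mulmx1. Qed.

Definition sstable r k (rho : rep r) (U : 'M[F]_(k, r)) :=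
  forall A, S A -> (U *m rho A <= U)%MS.

(** The action in coordinates with respect to [row_base U]; [pinvmx] recovers the coordinates of a
    vector of the row space. It is the submodule action as soon as [U] is stable. *)
Definition subrep r k (rho : rep r) (U : 'M[F]_(k, r)) : rep (\rank U) :=
  fun A => row_base U *m rho A *m pinvmx (row_base U).

Section Submodule.
Variables (r k : nat) (rho : rep r) (U : 'M[F]_(k, r)).
Hypotheses (rhoP : is_smodule rho) (stU : sstable rho U).

Lemma subrepE A : S A ->
  subrep rho U A *m row_base U = row_base U *m rho A.
Proof.
move=> SA; apply: mulmxKpV.
by rewrite eq_row_base (eqmxMr _ (eq_row_base U)) stU.
Qed.

Lemma row_baseI q (X Z : 'M_(q, \rank U)) :
  X *m row_base U = Z *m row_base U -> X = Z.
Proof. exact/row_free_inj/row_base_free. Qed.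

Lemma shom_row_base : is_shom (subrep rho U) rho (row_base U).
Proof. exact: subrepE. Qed.

Lemma subrep_smodule : is_smodule (subrep rho U).
Proof.
case: rhoP => rM rL r1; split=> [A B SA SB | c A B SA SB |].
- apply: row_baseI; rewrite subrepE ?rM //; last exact: inSchurM.
  by rewrite -mulmxA subrepE // [RHS]mulmxA subrepE // mulmxA.
- apply: row_baseI; rewrite subrepE ?rL //; last exact: inSchurZD.
  by rewrite mulmxDl mulmxDr -scalemxAl -scalemxAr !subrepE.
- by apply: row_baseI; rewrite subrepE ?r1 ?mulmx1 ?mul1mx //; apply: inSchur1.
Qed.

Lemma shom_corestr r1 (rho1 : rep r1) (f : 'M_(r1, r)) :
    is_shom rho1 rho f -> (f <= U)%MS ->
  exists2 g, is_shom rho1 (subrep rho U) g & g *m row_base U = f.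
Proof.
move=> Hf fU; have gE : f *m pinvmx (row_base U) *m row_base U = f.
  by apply: mulmxKpV; rewrite eq_row_base.
exists (f *m pinvmx (row_base U)) => // A SA.
apply: row_baseI; rewrite -(mulmxA (rho1 A)) gE Hf //.
by rewrite -(mulmxA _ (subrep _ _ _)) subrepE // mulmxA gE.
Qed.

End Submodule.

(** [is_sproj] lifts only along surjections, so [f] and [g] are first corestricted to the image of
    [g], a submodule onto which [g] is surjective. *)
Lemma sproj_lift r (rho : rep r) r1 (rho1 : rep r1) r2 (rho2 : rep r2)
    (g : 'M_(r1, r2)) (f : 'M_(r, r2)) :
    is_sproj rho -> is_smodule rho1 -> is_smodule rho2 ->
    is_shom rho1 rho2 g -> is_shom rho rho2 f -> (f <= g)%MS ->
  exists2 h, is_shom rho rho1 h & h *m g = f.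
Proof.
move=> Pr M1 M2 Hg Hf fg.
have stg : sstable rho2 g by move=> A SA; rewrite -Hg // submxMl.
have [g' Hg' g'E] := shom_corestr stg Hg (submx_refl g).
have [f' Hf' f'E] := shom_corestr stg Hf fg.
have fullg' : row_full g'.
  rewrite -sub1mx -(submxMfree _ _ (row_base_free g)) mul1mx g'E.
  by rewrite eq_row_base.
have [h [Hh hE]] := Pr _ _ _ _ g' f' M1 (subrep_smodule M2 stg) Hg' fullg' Hf'.
by exists h => //; rewrite -g'E mulmxA hE f'E.
Qed.

(* [f] lifts through epimorphisms as if it factored through a projective. *)
Definition liftable r (rho : rep r) r' (rho' : rep r') (f : 'M_(r, r')) :=
  forall r1 r2 (rho1 : rep r1) (rho2 : rep r2)
         (g : 'M[F]_(r1, r2)) (t : 'M[F]_(r', r2)),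
    is_smodule rho1 -> is_smodule rho2 -> is_shom rho1 rho2 g -> row_full g ->
    is_shom rho' rho2 t ->
  exists2 h, is_shom rho rho1 h & h *m g = f *m t.

(** Projectivity of Q will be obtained in this form: its identity is a sum of maps that each factor
    through a projective module. *)
Lemma liftable_sproj r (rho : rep r) : liftable rho rho 1%:M -> is_sproj rho.
Proof.
move=> L r1 r2 rho1 rho2 g f M1 M2 Hg fg Hf.
by have [h Hh hE] := L _ _ _ _ _ _ M1 M2 Hg fg Hf; exists h; rewrite hE mul1mx.
Qed.

Lemma liftableD r (rho : rep r) r' (rho' : rep r') (f1 f2 : 'M_(r, r')) :
  liftable rho rho' f1 -> liftable rho rho' f2 -> liftable rho rho' (f1 + f2).
Proof.
move=> L1 L2 r1 r2 rho1 rho2 g t M1 M2 Hg fg Ht.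
have [h1 Hh1 h1E] := L1 _ _ _ _ _ _ M1 M2 Hg fg Ht.
have [h2 Hh2 h2E] := L2 _ _ _ _ _ _ M1 M2 Hg fg Ht.
by exists (h1 + h2); [apply: shomD | rewrite !mulmxDl h1E h2E].
Qed.

Lemma liftable_factor r (rho : rep r) r' (rho' : rep r') rT (rhoT : rep rT)
    (a : 'M_(r, rT)) (b : 'M_(rT, r')) :
    is_sproj rhoT -> is_shom rho rhoT a -> is_shom rhoT rho' b ->
  liftable rho rho' (a *m b).
Proof.
move=> PT Ha Hb r1 r2 rho1 rho2 g t M1 M2 Hg fg Ht.
have [h [Hh hE]] := PT _ _ _ _ g _ M1 M2 Hg fg (shomM Hb Ht).
by exists (a *m h); [apply: shomM Hh | rewrite -mulmxA hE mulmxA].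
Qed.

(** * Comparison of a finite projective resolution with a periodic one *)

Section Periodic.
Variables (rQ : nat) (rhoQ : rep rQ) (D : 'M[F]_rQ).
Hypotheses (MQ : is_smodule rhoQ) (PQ : is_sproj rhoQ).
Hypotheses (HD : is_shom rhoQ rhoQ D) (exD : (D == kermx D)%MS).

Let DD : D *m D = 0. Proof. by apply/sub_kermxP; case/andP: exD. Qed.

Let sstableD : sstable rhoQ D.
Proof. by move=> A SA; rewrite -HD // submxMl. Qed.

Let lift_exact r1 r2 r3 (rho1 : rep r1) (rho2 : rep r2)
    (d1 : 'M_(r1, r2)) (d0 : 'M_(r2, r3)) r (rho : rep r) (f : 'M_(r, r2)) :
    is_sproj rho -> is_smodule rho1 -> is_smodule rho2 ->
    is_shom rho1 rho2 d1 -> (d1 == kermx d0)%MS -> is_shom rho rho2 f ->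
    f *m d0 = 0 ->
  exists2 h, is_shom rho rho1 h & h *m d1 = f.
Proof.
move=> Pr M1 M2 Hd1 /andP[_ ex] Hf f0.
by apply: sproj_lift Hf _ => //; apply: submx_trans ex; apply/sub_kermxP.
Qed.

(* A finite projective resolution P of M = im D is compared with the periodic
   resolution D : Q -> Q -> M by maps [f : Q -> P_i], [g : P_i -> Q] and a
   homotopy [k]; the three equations are what is needed to go from i to i+1,
   and once the differential [e] out of P_i is injective they give D = D k D. *)
Let compare r r' (rho : rep r) (e : 'M_(r, r')) :=
  exists f : 'M_(rQ, r), exists g : 'M_(r, rQ), exists k : 'M_rQ,
  [/\ is_shom rhoQ rho f, is_shom rho rhoQ g, is_shom rhoQ rhoQ k &
  [/\ D *m f *m e = 0, kermx e *m g *m D = 0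
    & D *m (1%:M - f *m g - k *m D) = 0]].

Let compare_step r r' r'' (rho : rep r) (e : 'M_(r, r'))
    (rho2 : rep r'') (e2 : 'M_(r'', r)) :
    is_smodule rho -> is_smodule rho2 -> is_sproj rho2 ->
    is_shom rho2 rho e2 -> (e2 == kermx e)%MS ->
  compare rho e -> compare rho2 e2.
Proof.
move=> M1 M2 P2 He2 ex [f [g [k [Hf Hg Hk [Df eg Dk]]]]].
have [f' Hf' f'E] := lift_exact PQ M2 M1 He2 ex (shomM HD Hf) Df.
have e2g : e2 *m g *m D = 0.
  have /submxP[X ->] : (e2 <= kermx e)%MS by case/andP: ex.
  by rewrite -2!(mulmxA X) eg mulmx0.
have [g' Hg' g'E] := lift_exact P2 MQ MQ HD exD (shomM He2 Hg) e2g.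
(* [t] is what [f' *m g'] and the old homotopy leave of the identity. The third equation of the
   previous stage gives [t *m D = 0], so exactness yields the new homotopy [k'] with
   [k' *m D = t]. *)
pose t := 1%:M - f' *m g' - D *m k.
have Ht : is_shom rhoQ rhoQ t.
  apply: shomB; last exact: shomM HD Hk.
  by apply: shomB; [apply: shom1 | apply: shomM Hg'].
have t0 : t *m D = 0.
  rewrite /t !mulmxBl mul1mx -(mulmxA f') g'E (mulmxA f') f'E.
  by rewrite -[RHS]Dk !mulmxBr mulmx1 !mulmxA.
have [k' Hk' k'E] := lift_exact PQ MQ MQ HD exD Ht t0.
exists f', g', k'; split=> //; split.
- by rewrite -mulmxA f'E mulmxA DD mul0mx.
- by rewrite -mulmxA g'E mulmxA mulmx_ker mul0mx.
- by rewrite k'E /t opprB addrC subrK mulmxA DD mul0mx.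
Qed.

Let compare_final r r' (rho : rep r) (e : 'M_(r, r')) :
    row_free e -> compare rho e ->
  exists2 k, is_shom rhoQ rhoQ k & D = D *m k *m D.
Proof.
move=> fe [f [g [k [_ _ Hk [Df _ Dk]]]]]; exists k => //.
(* Finiteness of the resolution enters here: the last differential is injective and can be
   cancelled. *)
have Df0 : D *m f = 0 by apply: (row_free_inj fe); rewrite Df mul0mx.
move/eqP: Dk; rewrite !mulmxBr mulmx1 !mulmxA Df0 mul0mx subr0 subr_eq0.
by move/eqP.
Qed.

Lemma pd_le_split len :
    pd_le len (subrep rhoQ D) ->
  exists2 k, is_shom rhoQ rhoQ k & D = D *m k *m D.
Proof.
case=> r [rho [d0 [dd [MP [Hd0 fd0] Hdd ex0 [ex frd]]]]].
have MM := subrep_smodule MQ sstableD.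
(* [q] is [D] seen as a surjection of Q onto im D, the augmentation of the periodic resolution. *)
have [q Hq qE] := shom_corestr sstableD HD (submx_refl D).
have fq : row_full q.
  rewrite -sub1mx -(submxMfree _ _ (row_base_free D)) mul1mx qE.
  by rewrite eq_row_base.
have Dq : D *m q = 0.
  by apply: (row_free_inj (row_base_free D)); rewrite -mulmxA qE mul0mx DD.
have cmp0 : compare (rho 0%N) d0.
  have [M0 P0] := MP 0%N isT.
  have [f Hf fE] := sproj_lift PQ M0 MM Hd0 Hq (submx_full _ fd0).
  have [g Hg gE] := sproj_lift P0 MQ MM Hq Hd0 (submx_full _ fq).
  have Ht : is_shom rhoQ rhoQ (1%:M - f *m g).
    by apply: shomB; [apply: shom1 | apply: shomM Hg].
  have t0 : (1%:M - f *m g) *m D = 0.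
    by rewrite -qE mulmxA mulmxBl mul1mx -mulmxA gE fE subrr mul0mx.
  have [k Hk kE] := lift_exact PQ MQ MQ HD exD Ht t0.
  exists f, g, k; split=> //; split; first by rewrite -mulmxA fE.
    have gD : g *m D = d0 *m row_base D by rewrite -gE -mulmxA qE.
    by rewrite -mulmxA gD mulmxA mulmx_ker mul0mx.
  by rewrite kE subrr mulmx0.
(* In length 0 the augmentation [d0] is itself the injective last map. *)
case: len => [|len] in MP Hdd ex0 ex frd *.
  exact: compare_final ex0 cmp0.
suff cmp i : (i < len.+1)%N -> compare (rho i.+1) (dd i).
  exact: compare_final frd (cmp len (ltnSn len)).
elim: i => [|i IH] lt_i.
  have [M0 _] := MP 0%N isT; have [M1 P1] := MP 1%N lt_i.
  exact: compare_step M0 M1 P1 (Hdd _ lt_i) ex0 cmp0.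
have [M1 _] := MP i.+1 (ltnW lt_i); have [M2 P2] := MP i.+2 lt_i.
by apply: compare_step M1 M2 P2 (Hdd _ lt_i) (ex _ lt_i) (IH (ltnW lt_i)).
Qed.

End Periodic.
End ModuleTheory.

(** * Signed place permutations *)

Section PlacePermutations.
Variables (F : fieldType) (m n d : nat).
Local Notation N := (sdim m n d).
Local Notation S := (@inSchur F m n d).
Local Notation word := (sword m n d).
Implicit Types (x y : word) (s t : 'S_d).

(** The exclusive or makes this symmetric in [i] and [j], so that products over pairs [i < j] can be
    reindexed by a permutation. *)
Definition inverted s (i j : 'I_d) : bool := ((i < j) (+) (s i < s j))%N.

Lemma invertedM s t i j :
  inverted (s * t) i j = inverted s i j (+) inverted t (s i) (s j).
Proof. by rewrite /inverted !permM; do 3!case: (_ < _)%N. Qed.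

Lemma invertedC s i j : inverted s j i = inverted s i j.
Proof.
rewrite /inverted; case: (ltngtP i j) => [ij|ij|/val_inj-> //].
- have /eqP : s i <> s j by move/perm_inj=> e; rewrite e ltnn in ij.
  by rewrite -val_eqE /=; case: ltngtP.
- have /eqP : s i <> s j by move/perm_inj=> e; rewrite e ltnn in ij.
  by rewrite -val_eqE /=; case: ltngtP.
Qed.

(** [s] permutes the unordered pairs. After reindexing by its inverse, the pairs whose order is
    preserved match directly, and the others match after swapping their entries. *)
Lemma prod_pairs_perm (f : 'I_d -> 'I_d -> F) s :
    (forall i j, f i j = f j i) ->
  \prod_(q : 'I_d * 'I_d | (q.1 < q.2)%N) f (s q.1) (s q.2)
  = \prod_(q : 'I_d * 'I_d | (q.1 < q.2)%N) f q.1 q.2.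
Proof.
move=> fC; pose h (q : 'I_d * 'I_d) := ((s^-1)%g q.1, (s^-1)%g q.2).
pose sw (q : 'I_d * 'I_d) := (q.2, q.1).
rewrite (reindex_inj (h := h)) /=; last first.
  by move=> [i j] [i' j'] [/perm_inj -> /perm_inj ->].
under eq_bigr do rewrite !permKV.
rewrite (bigID (fun q : 'I_d * 'I_d => (q.1 < q.2)%N)) /=.
rewrite [RHS](bigID (fun q : 'I_d * 'I_d => ((s^-1)%g q.1 < (s^-1)%g q.2)%N)) /=.
congr (_ * _); first by apply: eq_bigl => q; rewrite andbC.
rewrite (reindex_inj (h := sw)) /=; last by move=> [i j] [i' j'] [-> ->].
apply: eq_big => [[i j]|[i j] _] /=; last exact: fC.
case: (ltngtP i j) => [ij|ij|/val_inj->]; rewrite /= ?andbT ?andbF ?ltnn //.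
have /eqP : (s^-1)%g i <> (s^-1)%g j by move/perm_inj=> e; rewrite e ltnn in ij.
by rewrite -val_eqE /=; case: ltngtP.
Qed.

(** The inverse makes this a right action, products of permutations being read from left to right:
    the letter at place [i] moves to place [s i]. *)
Definition wact x s : word := [ffun t => x ((s^-1)%g t)].

Lemma wactM x s t : wact x (s * t) = wact (wact x s) t.
Proof. by apply/ffunP=> i; rewrite !ffunE invMg permM. Qed.

Lemma wact1 x : wact x 1 = x.
Proof. by apply/ffunP=> i; rewrite ffunE invg1 perm1. Qed.

Lemma wact_inj s : injective (wact^~ s).
Proof. by apply: (can_inj (g := wact^~ s^-1%g)) => x; rewrite -wactM mulgV wact1. Qed.

(** The Koszul sign: a factor -1 for each inverted pair of odd letters. *)
Definition wsign x s : F :=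
  \prod_(q : 'I_d * 'I_d | (q.1 < q.2)%N)
     (-1) ^+ [&& inverted s q.1 q.2, odd_idx (x q.1) & odd_idx (x q.2)].

(** Inversions of a product add modulo 2; the pairs that [t] sees after [s] has acted are reindexed
    by [s]. This cocycle rule makes [pmx] multiplicative. *)
Lemma wsignM x s t : wsign x (s * t) = wsign x s * wsign (wact x s) t.
Proof.
pose f i j := ((-1) ^+ [&& inverted t i j, odd_idx (wact x s i)
                         & odd_idx (wact x s j)] : F).
have fC i j : f i j = f j i.
  by rewrite /f invertedC (andbC (odd_idx (wact x s i))).
rewrite [wsign (wact x s) t](_ : _ =
  \prod_(q : 'I_d * 'I_d | (q.1 < q.2)%N) f q.1 q.2) //.
rewrite -(prod_pairs_perm s fC) -big_split /=.
apply: eq_bigr => -[i j] _ /=; rewrite /f !ffunE !permK invertedM.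
by case: (inverted s i j); case: (inverted t _ _); case: (odd_idx (x i));
  case: (odd_idx (x j)); rewrite ?mulr1 ?mul1r ?mulrNN ?expr0 ?mulr1.
Qed.

Lemma wsign1 x : wsign x 1 = 1.
Proof.
by apply: big1 => -[i j] _ /=; rewrite /inverted !perm1 addbb.
Qed.

Lemma wsignV x s : wsign x s * wsign (wact x s) s^-1 = 1.
Proof. by rewrite -wsignM mulgV wsign1. Qed.

Definition ev x : 'rV[F]_N := delta_mx 0 (enum_rank x).

Lemma row_ev k (A : 'M[F]_(N, k)) x : ev x *m A = row (enum_rank x) A.
Proof. by rewrite rowE. Qed.

Lemma ev_ext k (A B : 'M[F]_(N, k)) :
  (forall x, ev x *m A = ev x *m B) -> A = B.
Proof.
move=> AB; apply/row_matrixP => a.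
by have := AB (enum_val a); rewrite !row_ev enum_valK.
Qed.

Definition crd (w : 'rV[F]_N) x := w 0 (enum_rank x).

Lemma crd_ev x y : crd (ev x) y = (x == y)%:R.
Proof. by rewrite /crd mxE eqxx /= (inj_eq enum_rank_inj) eq_sym. Qed.

Lemma crdZ a w x : crd (a *: w) x = a * crd w x.
Proof. by rewrite /crd mxE. Qed.

Lemma crd_sum (I : finType) (P : pred I) (f : I -> 'rV_N) x :
  crd (\sum_(i | P i) f i) x = \sum_(i | P i) crd (f i) x.
Proof. by rewrite /crd summxE. Qed.

Lemma crd_ext w w' : crd w =1 crd w' -> w = w'.
Proof.
move=> ww; apply/rowP => a.
by have := ww (enum_val a); rewrite /crd enum_valK.
Qed.

Lemma ev_sum w : w = \sum_x crd w x *: ev x.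
Proof.
apply: crd_ext => y; rewrite crd_sum (bigD1 y) //= big1.
  by rewrite crdZ crd_ev eqxx mulr1 addr0.
by move=> x /negbTE xy; rewrite crdZ crd_ev xy mulr0.
Qed.

Definition pmx s : 'M[F]_N :=
  \matrix_(a, b) if enum_val b == wact (enum_val a) s
                 then wsign (enum_val a) s else 0.

Lemma ev_pmx x s : ev x *m pmx s = wsign x s *: ev (wact x s).
Proof.
rewrite row_ev; apply/rowP => b; rewrite !mxE enum_rankK eqxx /=.
have -> : (b == enum_rank (wact x s)) = (enum_val b == wact x s).
  by rewrite -(inj_eq enum_val_inj) enum_rankK.
by case: eqP; rewrite (mulr1, mulr0).
Qed.

Lemma pmxM s t : pmx (s * t) = pmx s *m pmx t.
Proof.
apply: ev_ext => x; rewrite mulmxA !ev_pmx -scalemxAl ev_pmx scalerA.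
by rewrite wactM wsignM.
Qed.

Lemma pmx1 : pmx 1 = 1%:M.
Proof. by apply: ev_ext => x; rewrite ev_pmx mulmx1 wsign1 wact1 scale1r. Qed.

Lemma crd_pmx w x s : crd (w *m pmx s) (wact x s) = wsign x s * crd w x.
Proof.
rewrite {1}(ev_sum w) mulmx_suml crd_sum (bigD1 x) //= big1 ?addr0.
  by rewrite -scalemxAl ev_pmx !crdZ crd_ev eqxx mulr1 mulrC.
move=> y /negbTE yx; rewrite -scalemxAl ev_pmx !crdZ crd_ev.
by rewrite (inj_eq (@wact_inj s)) yx !mulr0.
Qed.

Lemma inverted_tperm_adj (j k i l : 'I_d) :
    k = j.+1 :> nat -> (i < l)%N ->
  inverted (tperm j k) i l = (i == j) && (l == k).
Proof.
move=> jk; rewrite /inverted -!val_eqE /=.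
by case: tpermP => [->|->|/eqP + /eqP +]; case: tpermP => [->|->|/eqP + /eqP +];
   rewrite -?val_eqE /=; lia.
Qed.

Lemma pmx_tperm (j k : 'I_d) :
  k = j.+1 :> nat -> pmx (tperm j k) = @gen_mx F m n d j k.
Proof.
move=> jk; apply/matrixP => a b; rewrite !mxE.
have -> : wact (enum_val a) (tperm j k) =
          [ffun t => (enum_val a : word) (tperm j k t)].
  by apply/ffunP=> t; rewrite !ffunE tpermV.
rewrite /=; case: eqP => // _; rewrite /wsign (bigD1 (j, k)) /= ?jk // big1 ?mulr1.
  by rewrite inverted_tperm_adj ?jk // !eqxx.
move=> [i l] /= /andP[il ne]; rewrite inverted_tperm_adj //.
by move: ne; rewrite xpair_eqE => /negbTE->.
Qed.

(** [inSchur] asks only for commutation with adjacent transpositions. Conjugation by these reaches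
    all transpositions, by induction on the distance of the two places, and transpositions
    generate. *)
Lemma inSchur_pmx A s : S A -> A *m pmx s = pmx s *m A.
Proof.
move=> SA.
have cM s1 s2 : A *m pmx s1 = pmx s1 *m A -> A *m pmx s2 = pmx s2 *m A ->
    A *m pmx (s1 * s2) = pmx (s1 * s2) *m A.
  by move=> c1 c2; rewrite pmxM mulmxA c1 -mulmxA c2 mulmxA.
have cT k (i j : 'I_d) : (j = i + k.+1 :> nat)%N ->
    A *m pmx (tperm i j) = pmx (tperm i j) *m A.
  elim: k j => [|k IH] j ji; first by rewrite pmx_tperm ?SA //; lia.
  have lt_j' : (i + k.+1 < d)%N by have := ltn_ord j; lia.
  pose j' := Ordinal lt_j'.
  have c1 := IH j' erefl.
  have c2 : A *m pmx (tperm j' j) = pmx (tperm j' j) *m A.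
    by rewrite pmx_tperm ?SA //= ji; lia.
  have -> : tperm i j = (tperm j' j * tperm i j' * tperm j' j)%g.
    have := tpermJ i j' (tperm j' j); rewrite /conjg tpermV tpermL => e.
    by rewrite tpermD in e; rewrite -?e ?mulgA // -val_eqE /=; lia.
  by apply: (cM) => //; apply: (cM).
have [ts -> _] := prod_tpermP s.
elim/big_ind: _ => [|s1 s2|[i j] _ /=].
- by rewrite pmx1 mulmx1 mul1mx.
- exact: cM.
- case: (ltngtP i j) => [ij|ij|/val_inj->].
  + by apply: (cT (j - i).-1); lia.
  + by rewrite tpermC; apply: (cT (i - j).-1); lia.
  + by rewrite tperm1 pmx1 mulmx1 mul1mx.
Qed.

Definition invsign s : F :=
  \prod_(q : 'I_d * 'I_d | (q.1 < q.2)%N) (-1) ^+ inverted s q.1 q.2.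

Lemma invsignM s t : invsign (s * t) = invsign s * invsign t.
Proof.
pose f i j := ((-1) ^+ inverted t i j : F).
have fC i j : f i j = f j i by rewrite /f invertedC.
rewrite [invsign t](_ : _ = \prod_(q : 'I_d * 'I_d | (q.1 < q.2)%N) f q.1 q.2) //.
rewrite -(prod_pairs_perm s fC) -big_split /=.
apply: eq_bigr => -[i j] _ /=; rewrite /f invertedM.
by case: (inverted s i j); case: (inverted t _ _);
  rewrite ?mulr1 ?mul1r ?mulrNN ?expr0 ?mulr1.
Qed.

Lemma invsign_adj (j k : 'I_d) : k = j.+1 :> nat -> invsign (tperm j k) = -1.
Proof.
move=> jk; rewrite /invsign (bigD1 (j, k)) /= ?jk // big1 ?mulr1.
  by rewrite inverted_tperm_adj ?jk // !eqxx.
move=> [i l] /= /andP[il ne]; rewrite inverted_tperm_adj //.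
by move: ne; rewrite xpair_eqE => /negbTE->.
Qed.

Lemma invsign1 : invsign 1 = 1.
Proof. by apply: big1 => -[i j] _ /=; rewrite /inverted !perm1 addbb. Qed.

(** Both signs are multiplicative, and both are -1 on transpositions, by the same induction on
    distance as in [inSchur_pmx]. *)
Lemma invsignE s : invsign s = (-1) ^+ odd_perm s.
Proof.
have cT k (i j : 'I_d) : (j = i + k.+1 :> nat)%N -> invsign (tperm i j) = -1.
  elim: k j => [|k IH] j ji; first by rewrite invsign_adj //; lia.
  have lt_j' : (i + k.+1 < d)%N by have := ltn_ord j; lia.
  pose j' := Ordinal lt_j'.
  have c1 := IH j' erefl.
  have c2 : invsign (tperm j' j) = -1 by rewrite invsign_adj //= ji; lia.
  have -> : tperm i j = (tperm j' j * tperm i j' * tperm j' j)%g.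
    have := tpermJ i j' (tperm j' j); rewrite /conjg tpermV tpermL => e.
    by rewrite tpermD in e; rewrite -?e ?mulgA // -val_eqE /=; lia.
  by rewrite !invsignM c1 c2 mulrNN mulr1 mul1r.
have [ts -> dts] := prod_tpermP s.
elim: ts dts => [|[i j] ts IH] /=; first by rewrite big_nil invsign1 odd_perm1.
case/andP=> /= ij dts; rewrite big_cons invsignM IH // odd_mul_tperm ij signr_addb.
congr (_ * _); case: (ltngtP i j) => [lij|lij|/val_inj e].
- apply: (cT (j - i).-1); move: lij => /=; lia.
- rewrite tpermC; apply: (cT (i - j).-1); move: lij => /=; lia.
- by rewrite /dpair /= e eqxx in ij.
Qed.

End PlacePermutations.

(** * Projective modules of semi-invariants *)

(** Right multiplication by [t] permutes the right cosets, and [G] does not depend on the chosen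
    representatives. *)
Lemma sum_rcosets_mul (V : zmodType) (gT : finGroupType) (H A : {group gT})
    (G : gT -> V) t :
    t \in A -> (forall h s, h \in H -> G (h * s)%g = G s) ->
  \sum_(X in rcosets H A) G (repr X * t)%g = \sum_(X in rcosets H A) G (repr X).
Proof.
move=> tA GH.
have inX (X : {set gT}) : ((X :* t)%g \in rcosets H A) = (X \in rcosets H A).
  apply/rcosetsP/rcosetsP => [[s sA Xt]|[s sA ->]].
    exists (s * t^-1)%g; first by rewrite groupM ?groupV.
    by rewrite rcosetM -Xt -rcosetM mulgV mulg1.
  by exists (s * t)%g; rewrite ?groupM // rcosetM.
rewrite [RHS](reindex_inj (can_inj (rcosetK t))) /=.
apply: eq_big => X; first by rewrite inX.
case/rcosetsP=> s sA ->; rewrite -rcosetM.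
have [h hH ->] := rcosetP (mem_repr_rcoset H s).
have [h' h'H ->] := rcosetP (mem_repr_rcoset H (s * t)%g).
by rewrite -mulgA (GH h) // (GH h').
Qed.

Section SemiInvariants.
Variables (F : fieldType) (m n d : nat).
Local Notation N := (sdim m n d).
Local Notation S := (@inSchur F m n d).
Local Notation word := (sword m n d).
Local Notation pmx := (pmx F m n).
Local Notation ev := (ev F).
Implicit Types (x y : word) (s t : 'S_d) (chi : 'S_d -> F).

Definition natrep : 'M[F]_N -> 'M[F]_N := id.

Definition semiinv (H : {set 'S_d}) chi : 'M[F]_N :=
  (\bigcap_(s in H) kermx (pmx s - (chi s)%:M))%MS.

Lemma semiinvP (H : {set 'S_d}) chi k (w : 'M_(k, N)) :
  reflect (forall s, s \in H -> w *m pmx s = chi s *: w) (w <= semiinv H chi)%MS.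
Proof.
apply: (iffP sub_bigcapmxP) => [wU s sH|wU s sH].
  have /sub_kermxP := wU s sH; rewrite mulmxBr mul_mx_scalar => /eqP.
  by rewrite subr_eq0 => /eqP.
by apply/sub_kermxP; rewrite mulmxBr mul_mx_scalar wU ?subrr.
Qed.

Lemma semiinv_sstable H chi : sstable natrep (semiinv H chi).
Proof.
move=> A SA; apply/semiinvP => s sH; rewrite /natrep -mulmxA inSchur_pmx //.
by rewrite mulmxA (semiinvP _ _ _ (submx_refl _) s sH) scalemxAl.
Qed.

Lemma mulmx_evT (u : 'rV[F]_N) x : u *m (ev x)^T = (crd u x)%:M.
Proof. by rewrite trmx_delta -colE [col _ _]mx11_scalar mxE. Qed.

(** * Semi-invariants of a word stabilizer as the cyclic projective module e_x S *)

Section WordProjective.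
Variables (H : {group 'S_d}) (x : word).
Hypothesis stabx : forall s, (wact x s == x) = (s \in H).
Local Notation U := (semiinv H (wsign F x)).

(** The rank-one map sending e_x to [w] and all other words to 0, conjugated by [s]. *)
Definition wordop_term (w : 'rV[F]_N) s : 'M[F]_N :=
  pmx s^-1 *m ((ev x)^T *m w) *m pmx s.

(* The endomorphism of V^{(x)d} sending e_x to w. *)
Definition wordop w := \sum_(X in rcosets H [set: 'S_d]) wordop_term w (repr X).

Lemma wact_stab s : s \in H -> wact x s = x.
Proof. by move=> sH; apply/eqP; rewrite stabx. Qed.

Lemma wsign_stabV s : s \in H -> wsign F x s * wsign F x s^-1 = 1.
Proof. by move=> sH; rewrite -{2}(wact_stab sH) wsignV. Qed.

Lemma pmx_evT s : s \in H -> pmx s *m (ev x)^T = wsign F x s *: (ev x)^T.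
Proof.
move=> sH; apply: (@ev_ext F m n d) => y.
rewrite mulmxA ev_pmx -scalemxAl -scalemxAr !mulmx_evT !crd_ev.
rewrite -{1}(wact_stab sH) (inj_eq (@wact_inj m n d s)).
by case: eqP => [->|_] //; rewrite raddf0 !scaler0.
Qed.

Lemma wordop_termM w s t : wordop_term w (s * t) =
  pmx t^-1 *m wordop_term w s *m pmx t.
Proof. by rewrite /wordop_term invMg !pmxM !mulmxA. Qed.

(** The signs of [h] on [w] and of its inverse on the coordinate functional of [x] cancel, so the
    term depends only on the coset of [s]. *)
Lemma wordop_term_stab w h s : (w <= U)%MS -> h \in H ->
  wordop_term w (h * s)%g = wordop_term w s.
Proof.
move=> wU hH; rewrite /wordop_term invMg !pmxM -!mulmxA (mulmxA w).
have /semiinvP -> // := wU.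
rewrite (mulmxA (pmx h^-1)) pmx_evT ?groupV // -!scalemxAl -!scalemxAr scalerA.
by rewrite mulrC wsign_stabV ?scale1r.
Qed.

Lemma wordop_inSchur w : (w <= U)%MS -> S (wordop w).
Proof.
move=> wU j k jk; rewrite -pmx_tperm //; set t := tperm j k.
have GH h s (hH : h \in H) := wordop_term_stab s wU hH.
rewrite {2}/wordop -(sum_rcosets_mul (in_setT t) GH) mulmx_sumr mulmx_suml.
apply: eq_bigr => X _; rewrite wordop_termM !mulmxA -pmxM mulgV pmx1 mul1mx.
by rewrite /wordop_term !mulmxA.
Qed.

(** Only the coset [H] contributes: representatives of the others do not fix [x]. *)
Lemma ev_wordop w : ev x *m wordop w = w.
Proof.
rewrite mulmx_sumr (bigD1 (H : {set 'S_d})) /=; last first.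
  by apply/rcosetsP; exists 1%g; rewrite ?inE ?rcoset1.
rewrite repr_group /wordop_term invg1 pmx1 mulmx1 mul1mx mulmxA mulmx_evT.
rewrite crd_ev eqxx mul_scalar_mx scale1r big1 ?addr0 // => X.
case/andP=> /rcosetsP[s _ ->] nH; rewrite /wordop_term.
have [h hH ->] := rcosetP (mem_repr_rcoset H s).
rewrite !mulmxA ev_pmx -3!scalemxAl mulmx_evT crd_ev.
have -> : (wact x (h * s)^-1 == x) = false.
  rewrite stabx groupV groupMl //; apply: contraNF nH => sH.
  by rewrite rcoset_id.
by rewrite raddf0 !mul0mx scaler0.
Qed.

Lemma wordopM w A : S A -> wordop w *m A = wordop (w *m A).
Proof.
move=> SA; rewrite mulmx_suml; apply: eq_bigr => X _.
by rewrite /wordop_term -!mulmxA -(inSchur_pmx _ SA).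
Qed.

Lemma wordopZD c w w' : wordop (c *: w + w') = c *: wordop w + wordop w'.
Proof.
rewrite scaler_sumr -big_split; apply: eq_bigr => X _ /=.
rewrite /wordop_term !mulmxDr mulmxDl; congr (_ + _).
by rewrite -!scalemxAr -scalemxAl.
Qed.

Lemma ev_sub_semiinv : (ev x <= U)%MS.
Proof. by apply/semiinvP=> s sH; rewrite ev_pmx wact_stab. Qed.

Lemma smodule_wordop_sum r (rho : 'M[F]_N -> 'M[F]_r) k (a : 'rV_k)
    (w : 'M_(k, N)) (u : 'rV_r) : is_smodule rho -> (w <= U)%MS ->
  \sum_i a 0 i *: (u *m rho (wordop (row i w))) = u *m rho (wordop (a *m w)).
Proof.
case=> _ rL _ wU.
have r0 : rho 0 = 0.
  have S0 : S 0 by move=> j l _; rewrite mul0mx mulmx0.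
  have := rL 1 0 0 S0 S0.
  by rewrite scaler0 scale1r addr0 -{1}[rho 0]addr0 => /addrI/esym.
have w0 : wordop 0 = 0.
  by rewrite /wordop big1 // => X _; rewrite /wordop_term !mulmx0 mul0mx.
have rowU i : (row i w <= U)%MS by apply: submx_trans wU; apply: row_sub.
rewrite (mulmx_sum_row a).
(* [rho] is linear only on S, so the induction also carries membership of the partial sums in [U],
   which puts their [wordop] in S. *)
suff [] : ((\sum_i a 0 i *: row i w)%R <= U)%MS /\
  \sum_i a 0 i *: (u *m rho (wordop (row i w)))
    = u *m rho (wordop (\sum_i a 0 i *: row i w)) by [].
elim/big_rec2: _ => [|i v1 v2 _ [v2U ->]].
  by rewrite sub0mx w0 r0 mulmx0.
split; first by apply: addmx_sub => //; apply: scalemx_sub; apply: rowU.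
rewrite wordopZD rL; [|exact: wordop_inSchur|exact: wordop_inSchur].
by rewrite mulmxDr -scalemxAr.
Qed.

(** [U] is generated by e_x, and [wordop w] is an element of S sending e_x to [w]. A lift is
    therefore obtained from a single preimage [u] of the image of e_x, by sending [w] to
    [u *m rho1 (wordop w)]. *)
Lemma semiinv_sproj : is_sproj (subrep natrep U).
Proof.
move=> r1 r2 rho1 rho2 g f M1 M2 Hg fg Hf.
have stU := semiinv_sstable H (wsign F x); set I := row_base U.
have IU : (I <= U)%MS by rewrite eq_row_base.
have [e eE] : exists e : 'rV_(\rank U), e *m I = ev x.
  have /submxP[e eE] : (ev x <= I)%MS by rewrite eq_row_base ev_sub_semiinv.
  by exists e.
have [u uE] : exists u : 'rV_r1, u *m g = e *m f.
  by have /submxP[u ->] := submx_full (e *m f) fg; exists u.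
pose h := \matrix_i (u *m rho1 (wordop (row i I))).
have hE (a : 'rV_(\rank U)) : a *m h = u *m rho1 (wordop (a *m I)).
  rewrite -smodule_wordop_sum // (mulmx_sum_row a).
  by apply: eq_bigr => i _; rewrite rowK.
have SI i : S (wordop (row i I)).
  by apply: wordop_inSchur; apply: submx_trans IU; apply: row_sub.
exists h; split=> [A SA|]; apply/row_matrixP => i.
- rewrite [LHS]row_mul hE -row_mul (subrepE stU) // [RHS]row_mul rowK row_mul.
  rewrite -wordopM //.
  by case: M1 => -> // *; rewrite mulmxA.
- rewrite row_mul rowK -mulmxA Hg // mulmxA uE -mulmxA -Hf // mulmxA.
  suff -> : e *m subrep natrep U (wordop (row i I)) = delta_mx 0 i.
    by rewrite -rowE.
  apply: row_baseI; rewrite -mulmxA (subrepE stU) // mulmxA -/I eE ev_wordop.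
  by rewrite rowE.
Qed.

End WordProjective.
End SemiInvariants.

(** * Free orbits and power sums *)

Section FreeOrbits.
Variables (T : finType) (f : T -> T) (p : nat) (D : pred T).
Hypotheses (f_inj : injective f) (p_pr : prime p).
Hypotheses (Df : forall x, D (f x) = D x).
Hypotheses (iter_f : forall x, D x -> iter p f x = x).
Hypotheses (f_free : forall x, D x -> f x != x).

Lemma order_prime x : D x -> fingraph.order f x = p.
Proof.
move=> Dx; have o_gt0 := fingraph.order_gt0 f x.
have iterM k : iter (k * fingraph.order f x) f x = x.
  by elim: k => // k IH; rewrite mulSn iterD IH iter_order.
have : (fingraph.order f x %| p)%N.
  have := findex_iter (ltn_pmod p o_gt0).
  suff -> : iter (p %% fingraph.order f x) f x = x by rewrite findex0 /dvdn => <-.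
  have := iter_f Dx; rewrite {1}(divn_eq p (fingraph.order f x)) addnC iterD.
  by rewrite iterM.
case/primeP: p_pr => _ /[apply] /orP[/eqP o1|/eqP//].
have := f_free Dx; rewrite -[X in _ != X](iter_order f_inj x) o1 /=.
by rewrite eqxx.
Qed.

(** Each orbit has exactly p points and is listed from its root. It serves for the action of c on
    words, on cosets and on all permutations. *)
Lemma sum_free_orbits (V : zmodType) (G : T -> V) :
  \sum_(x | D x) G x
  = \sum_(x | D x && (froot f x == x)) \sum_(i < p) G (iter i f x).
Proof.
have Diter i x : D (iter i f x) = D x by elim: i => //= i <-.
have Droot x : D (froot f x) = D x.
  have /iter_findex <- := connect_root (frel f) x.
  by rewrite Diter.
rewrite (partition_big (froot f) (fun x => D x && (froot f x == x))) /=.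
  apply: eq_bigr => x /andP[Dx /eqP rx].
  transitivity (\sum_(y <- fingraph.orbit f x) G y).
    rewrite [RHS]big_uniq ?orbit_uniq //=; apply: eq_bigl => y.
    have -> : (y \in fingraph.orbit f x) = (froot f y == x).
      by rewrite -fconnect_orbit -(root_connect (fconnect_sym f_inj)) rx eq_sym.
    by case: eqP => e; rewrite ?andbF // andbT -Droot e Dx.
  rewrite /fingraph.orbit (order_prime Dx); elim: (p) => [|k IH].
    by rewrite big_nil big_ord0.
  by rewrite trajectSr big_rcons big_ord_recr /= IH.
by move=> x Dx; rewrite Droot Dx (root_root (fconnect_sym f_inj)) eqxx.
Qed.

End FreeOrbits.

Section PeriodicSums.
Variables (V : zmodType) (p : nat) (G : nat -> V).
Hypothesis G_per : forall i, G (i + p)%N = G i.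

Lemma periodicM i k : G (i + k * p)%N = G i.
Proof. by elim: k => [|k IH]; rewrite ?addn0 // mulSn addnCA addnC G_per. Qed.

Lemma periodic_mod i : G (i %% p)%N = G i.
Proof. by rewrite {2}(divn_eq i p) addnC periodicM. Qed.

Lemma sum_periodicD j : \sum_(i < p) G (i + j)%N = \sum_(i < p) G i.
Proof.
elim: j => [|j <-]; first by apply: eq_bigr => i _; rewrite addn0.
case: p G_per => [|q] Gq; first by rewrite !big_ord0.
rewrite big_ord_recr [RHS]big_ord_recl /= addrC add0n.
congr (_ + _); first by rewrite addnS -addSn addnC Gq.
by apply: eq_bigr => i _; rewrite /bump leq0n add1n addSnnS.
Qed.

Lemma sum_periodicM a : coprime a p -> \sum_(i < p) G (a * i)%N = \sum_(i < p) G i.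
Proof.
case: (posnP p) => [-> _|p_gt0 co]; first by rewrite !big_ord0.
pose h (i : 'I_p) := Ordinal (ltn_pmod (a * i) p_gt0).
have h_inj : injective h.
  move=> i j /(congr1 val) /= e.
  wlog le_ij : i j e / (i <= j)%N.
    by move=> W; case/orP: (leq_total i j) => le; [|apply/esym]; apply: W.
  have := e; move/esym/eqP; rewrite eqn_mod_dvd ?leq_mul // -mulnBr Gauss_dvdr.
    move=> dv; apply/val_inj => /=; have := ltn_ord j.
    by case: (posnP (j - i)) => [|/dvdn_leq/(_ dv)]; lia.
  by rewrite coprime_sym.
rewrite [RHS](reindex_inj h_inj); apply: eq_bigr => i _ /=.
by rewrite periodic_mod.
Qed.

End PeriodicSums.

(** * Power sums over the prime field *)

Section PowerSums.
Variables (F : fieldType) (p : nat).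
Hypotheses (p_char : p \in [pchar F]) (p_gt2 : (2 < p)%N).

Lemma p_prime : prime p. Proof. exact: pcharf_prime p_char. Qed.

Lemma natr_eq0 k : (k%:R == 0 :> F) = (p %| k)%N.
Proof. by rewrite (dvdn_pcharf p_char). Qed.

(** The term [i = 0] is included with [0 ^+ 0 = 1], so that [psum 0] is p, hence 0. *)
Definition psum k : F := \sum_(i < p) i%:R ^+ k.

Lemma natr_expp (i : nat) : (i%:R : F) ^+ p = i%:R.
Proof. by rewrite -(pFrobenius_autE p_char) pFrobenius_aut_nat. Qed.

(** Expand the telescoping sum of [i.+1%:R ^+ k.+1 - i%:R ^+ k.+1], whose value is a power of p,
    hence 0. *)
Lemma psum_recurrence k : \sum_(j < k.+1) psum j *+ 'C(k.+1, j) = 0.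
Proof.
transitivity (\sum_(i < p) ((i.+1%:R : F) ^+ k.+1 - i%:R ^+ k.+1)).
  rewrite (eq_bigr (fun j : 'I_k.+1 => \sum_(i < p)
     (i%:R : F) ^+ j *+ 'C(k.+1, j))); last by move=> j _; rewrite -sumrMnl.
  rewrite exchange_big; apply: eq_bigr => i _ /=.
  rewrite -natr1 (addrC _ 1) exprDn [in RHS]big_ord_recr /= expr1n mul1r binn.
  rewrite mulr1n addrK; apply: eq_bigr => j _; by rewrite expr1n mul1r.
rewrite -(big_mkord xpredT (fun i => (i.+1%:R : F) ^+ k.+1 - i%:R ^+ k.+1)).
rewrite telescope_sumr // expr0n subr0.
by rewrite (pcharf0 p_char) expr0n.
Qed.

(** In the recurrence all lower power sums vanish by induction, and the coefficient [k.+1] of the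
    last one is invertible. *)
Lemma psum_small k : (k < p.-1)%N -> psum k = 0.
Proof.
elim/ltn_ind: k => k IH kp; have := psum_recurrence k.
rewrite big_ord_recr big1 /= => [|j _]; last first.
  by rewrite IH ?mul0rn //; have := ltn_ord j; lia.
rewrite add0r binSn -mulr_natr => /eqP; rewrite mulf_eq0 natr_eq0.
by rewrite gtnNdvd ?orbF //; [move/eqP | lia].
Qed.

Lemma psum_pred : psum p.-1 = -1.
Proof.
have p_gt0 : (0 < p)%N by lia.
rewrite /psum -(big_mkord xpredT (fun i => (i%:R : F) ^+ p.-1)).
rewrite big_ltn // expr0n (_ : (p.-1 == 0)%N = false) /=; last by lia.
rewrite add0r big_nat (eq_bigr (fun=> 1)) => [|i /andP[i0 ip]].
  rewrite -big_nat sumr_const_nat subn1.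
  by apply/eqP; rewrite -subr_eq0 opprK natr1 prednK // (pcharf0 p_char).
have i_neq0 : i%:R != 0 :> F by rewrite natr_eq0 gtnNdvd.
by apply: (mulIf i_neq0); rewrite -exprSr prednK // natr_expp mul1r.
Qed.

Lemma psum_large k : (p.-1 < k < (p.-1).*2)%N -> psum k = 0.
Proof.
move=> kp; rewrite -(@psum_small (k - p.-1)); last by lia.
apply: eq_bigr => i _; have {1}-> : k = (p + (k - p))%N by lia.
by rewrite exprD natr_expp -exprS; congr (_ ^+ _); lia.
Qed.

End PowerSums.

(** * The group algebra of the p-cycle *)

Section Cyclic.
Variables (F : fieldType) (m n d p : nat).
Hypotheses (p_char : p \in [pchar F]) (p_gt2 : (2 < p)%N).
Variable c : 'S_d.
Hypothesis c_lt : forall i : 'I_d, (i < p)%N -> c i = (i.+1 %% p)%N :> nat.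
Hypothesis c_ge : forall i : 'I_d, (p <= i)%N -> c i = i.
Local Notation N := (sdim m n d).
Local Notation S := (@inSchur F m n d).
Local Notation word := (sword m n d).
Local Notation pmx := (pmx F m n).
Local Notation ev := (ev F).
Implicit Types (x y : word) (s t : 'S_d).

Let p_pr : prime p. Proof. exact: p_prime p_char. Qed.

Lemma cX_lt k (i : 'I_d) : (i < p)%N -> (c ^+ k)%g i = ((i + k) %% p)%N :> nat.
Proof.
move=> ip; elim: k => [|k IH]; first by rewrite expg0 perm1 addn0 modn_small.
rewrite expgSr permM c_lt; last by rewrite IH ltn_pmod //; lia.
by rewrite IH -addn1 modnDml addn1 addnS.
Qed.

Lemma cX_ge k (i : 'I_d) : (p <= i)%N -> (c ^+ k)%g i = i.
Proof.
move=> ip; elim: k => [|k IH]; first by rewrite expg0 perm1.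
by rewrite expgSr permM IH c_ge.
Qed.

Lemma cXp : (c ^+ p = 1)%g.
Proof.
apply/permP => i; rewrite perm1; case: (ltnP i p) => ip; last by rewrite cX_ge.
by apply/val_inj; rewrite /= cX_lt // modnDr modn_small.
Qed.

Lemma odd_c : odd_perm c = false.
Proof.
have := congr1 (@odd_perm _) cXp; rewrite odd_perm1.
have op : odd p by case: (even_prime p_pr) => // p2; move: p_gt2; rewrite p2.
suff -> k : odd_perm (c ^+ k) = odd k && odd_perm c by rewrite op.
elim: k => [|k IH]; first by rewrite expg0 odd_perm1.
by rewrite expgS odd_permM IH /=; case: (odd k); case: (odd_perm c).
Qed.

(** * Permutations of the first p places and words constant there *)

Definition supported s := forall i : 'I_d, (p <= i)%N -> s i = i.

Lemma supported_lt s (i : 'I_d) : supported s -> (i < p)%N -> (s i < p)%N.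
Proof.
move=> sS ip; rewrite ltnNge; apply/negP => pi; have /perm_inj e := sS _ pi.
by move: pi; rewrite e leqNgt ip.
Qed.

Lemma supportedV s : supported s -> supported s^-1.
Proof. by move=> sS i ip; rewrite -{1}(sS i ip) permK. Qed.

Lemma supportedM s t : supported s -> supported t -> supported (s * t).
Proof. by move=> sS tS i ip; rewrite permM sS ?tS. Qed.

Lemma supported_cX k : supported (c ^+ k).
Proof. by move=> i; apply: cX_ge. Qed.

(** A permutation of the block inverts no pair reaching outside it, so only pairs of letters of the
    common parity [b] count. *)
Lemma wsign_supported s x b : supported s ->
    (forall i : 'I_d, (i < p)%N -> odd_idx (x i) = b) ->
  wsign F x s = if b then invsign F s else 1.
Proof.
move=> sS xb; rewrite /wsign /invsign.
have -> : (if b then \prod_(q : 'I_d * 'I_d | (q.1 < q.2)%N)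
             (-1) ^+ inverted s q.1 q.2 else 1)
    = \prod_(q : 'I_d * 'I_d | (q.1 < q.2)%N)
         (-1) ^+ (inverted s q.1 q.2 && b) :> F.
  case: b {xb}; first by apply: eq_bigr => q _; rewrite andbT.
  by rewrite big1 // => q _; rewrite andbF.
apply: eq_bigr => -[i j] /= ij.
case: (ltnP j p) => jp; first by rewrite !xb ?andbb //; apply: ltn_trans jp.
suff -> : inverted s i j = false by [].
rewrite /inverted ij (sS _ jp); case: (ltnP i p) => ip; last by rewrite sS ?ij.
by rewrite (leq_trans (supported_lt sS ip) jp).
Qed.

Definition constant_word x :=
  [forall i : 'I_d, forall j : 'I_d, (i < p)%N && (j < p)%N ==> (x i == x j)].

Lemma constant_wordP x :
  reflect (forall i j : 'I_d, (i < p)%N -> (j < p)%N -> x i = x j)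
          (constant_word x).
Proof.
apply: (iffP forallP) => [cx i j ip jp|cx i].
  by have /forallP/(_ j) := cx i; rewrite ip jp => /eqP.
by apply/forallP => j; apply/implyP=> /andP[ip jp]; apply/eqP/cx.
Qed.

Lemma wact_constant s x : supported s -> constant_word x -> wact x s = x.
Proof.
move=> sS /constant_wordP cx; apply/ffunP=> i; rewrite ffunE.
case: (ltnP i p) => ip; last by rewrite supportedV.
by apply: cx => //; apply: supported_lt => //; apply: supportedV.
Qed.

Lemma constant_wact s x : supported s -> constant_word (wact x s) = constant_word x.
Proof.
move=> sS; have cw y t : supported t -> constant_word y -> constant_word (wact y t).
  by move=> tS cy; rewrite wact_constant.
apply/idP/idP => [/(cw _ _ (supportedV sS))|]; last exact: cw.
by rewrite -wactM mulgV wact1.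
Qed.

Lemma wsign_constant s x : supported s -> odd_perm s = false ->
  constant_word x -> wsign F x s = 1.
Proof.
move=> sS ev_s /constant_wordP cx.
have [/existsP[i ip]|/existsPn none] := boolP [exists i : 'I_d, (i < p)%N].
  rewrite (@wsign_supported s x (odd_idx (x i))) //.
    by rewrite invsignE ev_s; case: ifP.
  by move=> j jp; rewrite (cx j i).
rewrite (@wsign_supported s x false) // => i ip.
by have := none i; rewrite ip.
Qed.

(** The projection that splits off the constant words, the ones whose orbit under c is not free. *)
Definition cproj : 'M[F]_N :=
  \matrix_(a, b) ((a == b) && constant_word (enum_val a))%:R.

Lemma ev_cproj x : ev x *m cproj = (constant_word x)%:R *: ev x.
Proof.
rewrite row_ev; apply/rowP => b; rewrite !mxE eqxx enum_rankK eq_sym -natrM.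
by rewrite mulnb andbC.
Qed.

Lemma cproj_idem : cproj *m cproj = cproj.
Proof.
apply: ev_ext => x; rewrite mulmxA ev_cproj -scalemxAl ev_cproj scalerA -natrM.
by rewrite mulnb andbb.
Qed.

Lemma pmx_cproj s : supported s -> odd_perm s = false -> pmx s *m cproj = cproj.
Proof.
move=> sS ev_s; apply: ev_ext => x.
rewrite mulmxA ev_pmx -scalemxAl !ev_cproj constant_wact //.
case cx: (constant_word x); last by rewrite !scale0r scaler0.
by rewrite !scale1r wact_constant ?wsign_constant ?scale1r.
Qed.

Lemma cproj_pmx s : supported s -> odd_perm s = false -> cproj *m pmx s = cproj.
Proof.
move=> sS ev_s; apply: ev_ext => x.
rewrite mulmxA ev_cproj -scalemxAl ev_pmx.
case cx: (constant_word x); last by rewrite !scale0r.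
by rewrite !scale1r wact_constant ?wsign_constant ?scale1r.
Qed.

(** * Multiplication and annihilators in k<c> *)

Definition cycmx k := pmx (c ^+ k).

Lemma cycmxD i j : cycmx (i + j) = cycmx i *m cycmx j.
Proof. by rewrite /cycmx expgD pmxM. Qed.

Lemma cycmx_per i : cycmx (i + p) = cycmx i.
Proof. by rewrite /cycmx expgD cXp mulg1. Qed.

Lemma cycmx0 : cycmx 0 = 1%:M.
Proof. by rewrite /cycmx expg0 pmx1. Qed.

Lemma odd_cX k : odd_perm (c ^+ k) = false.
Proof.
elim: k => [|k IH]; first by rewrite expg0 odd_perm1.
by rewrite expgS odd_permM IH odd_c.
Qed.

Lemma cycmx_cproj k : cycmx k *m cproj = cproj.
Proof. by apply: pmx_cproj; [apply: supported_cX | apply: odd_cX]. Qed.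

Lemma cproj_cycmx k : cproj *m cycmx k = cproj.
Proof. by apply: cproj_pmx; [apply: supported_cX | apply: odd_cX]. Qed.

(* [ymx s] spans the power J^(p-1-s) of the augmentation ideal J of k<c>
   modulo J^(p-s). *)
Definition ymx (s : nat) : 'M[F]_N := \sum_(k < p) (k%:R ^+ s) *: cycmx k.

Lemma natr_per i : (i + p)%:R = i%:R :> F.
Proof. by rewrite natrD (pcharf0 p_char) addr0. Qed.

(** [k * p.-1] plays the part of [- k], so that exponents of c stay natural numbers. *)
Lemma natrBM i k : (i + k * p.-1)%:R = i%:R - k%:R :> F.
Proof.
have e : p.-1%:R = - 1 :> F.
  by apply/eqP; rewrite -subr_eq0 opprK natr1 prednK ?(pcharf0 p_char) //; lia.
by rewrite natrD natrM e mulrN1.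
Qed.

(** The coefficient of c^k is the convolution of i^s with i^t. Expanding (k - i)^t leaves power sums
    of exponents below 2(p-1), of which only the one of exponent p-1 survives; the binomial is 0
    when that exponent is not reached. *)
Lemma ymxM (s t : nat) : (s < p.-1)%N -> (t < p.-1)%N ->
  ymx s *m ymx t
  = (- ((-1) ^+ (p.-1 - s) *+ 'C(t, p.-1 - s))) *: ymx (t - (p.-1 - s)).
Proof.
move=> sp tp; set l0 := (p.-1 - s)%N.
have conv (k : nat) : \sum_(i < p) (i%:R ^+ s * (k%:R - i%:R) ^+ t)
    = - ((-1) ^+ l0 *+ 'C(t, l0)) * k%:R ^+ (t - l0) :> F.
  transitivity (\sum_(l < t.+1)
     (k%:R ^+ (t - l) * (-1) ^+ l *+ 'C(t, l)) * psum F p (s + l)).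
    under eq_bigr do rewrite exprDn mulr_sumr.
    rewrite exchange_big; apply: eq_bigr => l _ /=; rewrite mulr_sumr.
    apply: eq_bigr => i _; rewrite [(- i%:R) ^+ l]exprNn exprD.
    move: (i%:R ^+ s) (i%:R ^+ l) (k%:R ^+ (t - l)) ((-1) ^+ l) 'C(t, l).
    by move=> a1 a2 a3 a4 a5; ring.
  have psum0 (l : 'I_t.+1) : (l : nat) != l0 -> psum F p (s + l) = 0.
    move=> ne; case: (ltnP (s + l) p.-1) => sl; first by rewrite psum_small.
    by rewrite psum_large //; have := ltn_ord l; lia.
  case: (leqP l0 t) => lt; last first.
    rewrite bin_small // mulr0n oppr0 mul0r big1 // => l _.
    by rewrite psum0 ?mulr0 //; have := ltn_ord l; lia.
  rewrite (bigD1 (Ordinal (lt : (l0 < t.+1)%N))) //= big1 => [|l ne].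
    rewrite addr0 (_ : s + l0 = p.-1)%N ?psum_pred //; last by lia.
    by move: (k%:R ^+ (t - l0)) ((-1) ^+ l0) 'C(t, l0) => a1 a2 a3; ring.
  by rewrite psum0 ?mulr0.
transitivity (\sum_(i < p) \sum_(k < p)
   (i%:R ^+ s * (k%:R - i%:R) ^+ t : F) *: cycmx k).
  rewrite mulmx_suml; apply: eq_bigr => i _.
  rewrite mulmx_sumr.
  pose G j := ((i%:R : F) ^+ s * j%:R ^+ t) *: cycmx (i + j).
  have Gp j : G (j + p)%N = G j by rewrite /G natr_per addnA cycmx_per.
  transitivity (\sum_(j < p) G j).
    by apply: eq_bigr => j _; rewrite -scalemxAl -scalemxAr scalerA -cycmxD.
  rewrite -(sum_periodicD Gp (i * p.-1)); apply: eq_bigr => k _.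
  rewrite /G natrBM; congr (_ *: _).
  have -> : (i + (k + i * p.-1) = k + i * p)%N by rewrite mulnC -subn1; nia.
  by rewrite (periodicM cycmx_per).
rewrite exchange_big scaler_sumr; apply: eq_bigr => k _ /=.
by rewrite -scaler_suml conv scalerA.
Qed.

Lemma ymx_cycmx0 k : ymx 0 *m cycmx k = ymx 0.
Proof.
pose G i := ((i%:R : F) ^+ 0) *: cycmx i.
have Gp i : G (i + p)%N = G i by rewrite /G !expr0 cycmx_per.
have -> : ymx 0 = \sum_(i < p) G i by [].
rewrite -[RHS](sum_periodicD Gp k) mulmx_suml.
by apply: eq_bigr => i _; rewrite -scalemxAl -cycmxD /G !expr0.
Qed.

Lemma ymx_cproj (t : nat) : (t < p.-1)%N -> ymx t *m cproj = 0.
Proof.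
move=> tp; rewrite mulmx_suml.
under eq_bigr do rewrite -scalemxAl cycmx_cproj.
by rewrite -scaler_suml -[X in X *: _]/(psum F p t) psum_small ?scale0r.
Qed.

Lemma cycmxX u k : u *m cycmx 1 = u :> 'rV_N -> u *m cycmx k = u.
Proof.
move=> uc; elim: k => [|k IH]; first by rewrite cycmx0 mulmx1.
by rewrite -(addn1 k) cycmxD mulmxA IH.
Qed.

Lemma ymx_cinv u (t : nat) : u *m cycmx 1 = u :> 'rV_N -> (t < p.-1)%N ->
  u *m ymx t = 0.
Proof.
move=> uc tp; rewrite mulmx_sumr.
under eq_bigr do rewrite -scalemxAr cycmxX //.
by rewrite -scaler_suml -[X in X *: _]/(psum F p t) psum_small ?scale0r.
Qed.

(** Nonconstant words have free orbits under c, and an invariant vector restricted to such an orbit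
    is a multiple of the norm [ymx 0] of its root term. The constant words give [u *m cproj]. *)
Lemma cinv_decomp u : u *m cycmx 1 = u :> 'rV_N ->
  exists z, u = z *m ymx 0 + u *m cproj.
Proof.
move=> uc; pose f := (@wact m n d)^~ c.
pose G x := crd u x *: ev x.
have Gf x : G (f x) = G x *m cycmx 1.
  have ucx := crd_pmx u x c; rewrite -[c]expg1 -/(cycmx 1) uc in ucx.
  rewrite /G /f -scalemxAl ev_pmx scalerA -{1}[c]expg1 ucx mulrC.
  by rewrite expg1.
have iterf i x : iter i f x = wact x (c ^+ i).
  elim: i => [|i IH]; first by rewrite expg0 wact1.
  by rewrite iterS IH /f -wactM expgSr.
have Giter i x : G (iter i f x) = G x *m cycmx i.
  elim: i => [|i IH]; first by rewrite cycmx0 mulmx1.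
  by rewrite iterS Gf IH -mulmxA -cycmxD addn1.
(* A word fixed by c is fixed by its powers, and these are transitive on the first p places. *)
have free x : ~~ constant_word x -> f x != x.
  apply: contraNneq => fx; apply/constant_wordP.
  have xX k : wact x (c ^+ k) = x.
    by rewrite -iterf; elim: k => //= k ->.
  have x0 (i j : 'I_d) : (i < p)%N -> (j < p)%N -> (i <= j)%N -> x i = x j.
    move=> ip jp ij; have e : (c ^+ (j - i))%g i = j.
      by apply/val_inj; rewrite /= cX_lt // subnKC // modn_small.
    have := congr1 (fun y : word => y ((c ^+ (j - i))%g i)) (xX (j - i)%N).
    by rewrite ffunE permK e.
  move=> i j ip jp; case/orP: (leq_total i j) => ij; first exact: x0.
  by apply/esym/x0.
have sumG : u = \sum_(x | ~~ constant_word x) G x + u *m cproj.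
  rewrite {1}[u]ev_sum (bigID constant_word) /= addrC; congr (_ + _).
  rewrite [in RHS](ev_sum u) mulmx_suml [in RHS](bigID constant_word) /=.
  rewrite [X in _ = _ + X]big1 => [|x /negbTE cx].
    by rewrite addr0; apply: eq_bigr => x cx; rewrite -scalemxAl ev_cproj cx scale1r.
  by rewrite -scalemxAl ev_cproj cx scale0r scaler0.
exists (\sum_(x | ~~ constant_word x && (froot f x == x)) G x).
rewrite {1}sumG; congr (_ + _); rewrite (@sum_free_orbits _ f p) //.
- rewrite mulmx_suml; apply: eq_bigr => x _; rewrite mulmx_sumr.
  by apply: eq_bigr => i _; rewrite expr0 scale1r Giter.
- exact: wact_inj.
- by move=> x; rewrite /f constant_wact // -[c]expg1; apply: supported_cX.
- by move=> x _; rewrite iterf cXp wact1.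
Qed.

Lemma ymx_cycmx1 (s : nat) : ymx s *m cycmx 1
  = \sum_(j < s.+1) ((-1) ^+ j *+ 'C(s, j)) *: ymx (s - j).
Proof.
pose G k := (k%:R - 1 : F) ^+ s *: cycmx k.
transitivity (\sum_(k < p) G k).
  have Gp i : G (i + p)%N = G i by rewrite /G natr_per cycmx_per.
  rewrite -(sum_periodicD Gp 1).
  rewrite mulmx_suml; apply: eq_bigr => k _.
  by rewrite -scalemxAl -cycmxD /G natrD addrK.
under [RHS]eq_bigr do rewrite scaler_sumr.
rewrite [RHS]exchange_big; apply: eq_bigr => k _; rewrite /G exprDn scaler_suml.
apply: eq_bigr => j _; rewrite scalerA; congr (_ *: _).
by rewrite -mulrnAr mulrC.
Qed.

(** By Fermat k^(p-1) is 1 except at k = 0, where the identity drops out of the norm. *)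
Lemma ymx_pred : ymx p.-1 = ymx 0 - 1%:M.
Proof.
rewrite /ymx -(big_mkord xpredT (fun k => (k%:R : F) ^+ p.-1 *: cycmx k)).
rewrite -(big_mkord xpredT (fun k => (k%:R : F) ^+ 0 *: cycmx k)).
have p_gt0 : (0 < p)%N by lia.
rewrite big_ltn // [X in _ = X - _]big_ltn //.
rewrite mulr0n !expr0n (_ : (p.-1 == 0)%N = false) /=; last by lia.
rewrite scale0r scale1r cycmx0 add0r addrAC subrr add0r.
rewrite !big_nat; apply: eq_bigr => i /andP[i0 ip]; congr (_ *: _).
have i_neq0 : i%:R != 0 :> F by rewrite (natr_eq0 p_char) gtnNdvd.
by apply: (mulIf i_neq0); rewrite -exprSr prednK // (natr_expp p_char) expr0 mul1r.
Qed.

(** Multiplying by [ymx p.-2] lowers the index of [ymx] by one, up to an invertible scalar, so every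
    [ymx t] with t at most p-2 kills [u]. Then c fixes [u *m ymx p.-1], the difference of the
    invariant vector [u *m ymx 0] and [u]. *)
Lemma ymx_ker_cinv u : u *m ymx p.-2 = 0 :> 'rV_N -> u *m cycmx 1 = u.
Proof.
move=> uy.
have uY i : (i < p.-1)%N -> u *m ymx (p.-2 - i) = 0.
  elim: i => [|i IH] ip; first by rewrite subn0.
  have iF : (p.-2 - i)%:R != 0 :> F.
    by rewrite (natr_eq0 p_char) gtnNdvd //; lia.
  apply: (scalerI iF); rewrite scaler0 scalemxAr.
  have := ymxM (s := p.-2) (t := p.-2 - i).
  have -> : (p.-1 - p.-2 = 1)%N by lia.
  rewrite bin1 expr1 mulNrn opprK => Y.
  have -> : (p.-2 - i.+1 = p.-2 - i - 1)%N by lia.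
  by rewrite -Y ?mulmxA ?uy ?mul0mx //; lia.
have uYc : u *m ymx p.-1 *m cycmx 1 = u *m ymx p.-1.
  rewrite -mulmxA ymx_cycmx1 big_ord_recl /= subn0 expr0 bin0 mulr1n scale1r.
  rewrite mulmxDr [X in _ + X](_ : _ = 0) ?addr0 // mulmx_sumr.
  apply: big1 => j _.
  rewrite -scalemxAr /bump add1n.
  have -> : (p.-1 - j.+1 = p.-2 - j)%N by lia.
  by rewrite uY ?scaler0.
move: uYc; rewrite ymx_pred mulmxBr mulmx1 mulmxBl -mulmxA ymx_cycmx0.
by move/addrI/oppr_inj.
Qed.

Lemma ymx0_factor (t : nat) : (0 < t < p.-1)%N ->
  ymx 0 = (- (-1) ^+ t) *: (ymx (p.-1 - t) *m ymx t).
Proof.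
move=> tp; rewrite ymxM //; [|lia..].
have -> : (p.-1 - (p.-1 - t) = t)%N by lia.
rewrite binn subnn mulr1n scalerA mulrNN -expr2 sqrr_sign.
by rewrite scale1r.
Qed.

Lemma ymx_pred_factor (t : nat) : (0 < t < p.-1)%N ->
  exists X, ymx t.-1 = X *m ymx t.
Proof.
move=> tp; have tF : t%:R != 0 :> F.
  by rewrite (natr_eq0 p_char) gtnNdvd //; lia.
exists (t%:R^-1 *: ymx p.-2); rewrite -scalemxAl ymxM; [|lia..].
have -> : (p.-1 - p.-2 = 1)%N by lia.
by rewrite bin1 expr1 mulNrn opprK scalerA mulVf // scale1r subn1.
Qed.

(** On the free part the annihilator of J^(j+1) is J^(p-1-j), for J the augmentation ideal; the
    constant words account for [w]. *)
Lemma ymx_ker (j : nat) u : (j < p.-1)%N -> u *m ymx (p.-2 - j) = 0 :> 'rV_N ->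
  exists z, exists2 w, u = z *m ymx j + w & w *m cproj = w.
Proof.
elim: j u => [|j IH] u jp.
  rewrite subn0 => /ymx_ker_cinv /cinv_decomp[z uE].
  by exists z, (u *m cproj) => //; rewrite -mulmxA cproj_idem.
set t := (p.-2 - j)%N => uY.
have uYy : u *m ymx t *m ymx p.-2 = 0.
  rewrite -mulmxA ymxM /t; [|lia..].
  have -> : (p.-2 - (p.-1 - (p.-2 - j)) = p.-2 - j.+1)%N by lia.
  by rewrite -scalemxAr uY scaler0.
have [z zE] := cinv_decomp (ymx_ker_cinv uYy).
rewrite -(mulmxA u) ymx_cproj ?mulmx0 ?addr0 in zE; last by rewrite /t; lia.
(* [u *m ymx t] is the norm of [z], and the norm is a multiple of [ymx j.+1 *m ymx t]. Subtracting
   the corresponding multiple of [z *m ymx j.+1] leaves a vector killed by [ymx t], to which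
   induction applies. *)
pose u' := u - (- (-1) ^+ t) *: (z *m ymx j.+1).
have u'Y : u' *m ymx t = 0.
  rewrite /u' mulmxBl -scalemxAl -mulmxA scalemxAr.
  have -> : j.+1 = (p.-1 - t)%N by rewrite /t; lia.
  by rewrite -ymx0_factor ?zE ?subrr // /t; lia.
have [|z' [w uE wP]] := IH u' _ u'Y; first by lia.
have [|X XE] := ymx_pred_factor (t := j.+1); first by lia.
exists ((- (-1) ^+ t) *: z + z' *m X), w => //.
rewrite mulmxDl -(mulmxA z') -XE -addrA -uE -scalemxAl /u'.
by rewrite addrC subrK.
Qed.

(** The norm is a multiple of the square of [ymx h], so [u] can be corrected by im [ymx h] to a
    vector killed by [ymx h]. [ymx_ker] then leaves im [ymx h.-1], inside im [ymx h], and constant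
    words. *)
Lemma ymx_exact (h : nat) u : h.*2 = p.-1 ->
    u *m ymx h *m cycmx 1 = u *m ymx h :> 'rV_N ->
  exists v, exists2 w, u = v *m ymx h + w & w *m cycmx 1 = w.
Proof.
move=> hp /cinv_decomp[z]; rewrite -(mulmxA u) ymx_cproj ?mulmx0 ?addr0; last lia.
move=> zE; pose u' := u - (- (-1) ^+ h) *: (z *m ymx h).
have u'Y : u' *m ymx (p.-2 - h.-1) = 0.
  have -> : (p.-2 - h.-1 = h)%N by lia.
  rewrite /u' mulmxBl -scalemxAl -mulmxA scalemxAr.
  have {3}-> : h = (p.-1 - h)%N by lia.
  by rewrite -ymx0_factor ?zE ?subrr //; lia.
have [|z' [w uE wP]] := ymx_ker _ u'Y; first by lia.
have [|X XE] := ymx_pred_factor (t := h); first by lia.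
exists ((- (-1) ^+ h) *: z + z' *m X), w; last first.
  by rewrite -wP -mulmxA cproj_cycmx.
rewrite mulmxDl -(mulmxA z') -XE -addrA -uE -scalemxAl /u'.
by rewrite addrC subrK.
Qed.

End Cyclic.

(** * The normalizer of the p-cycle *)

Section Frobenius.
Variables (F : fieldType) (m n d p h : nat).
Hypotheses (p_char : p \in [pchar F]) (p_gt2 : (2 < p)%N) (hp : h.*2 = p.-1).
Hypothesis le_pd : (p <= d)%N.
Variable c : 'S_d.
Hypothesis c_lt : forall i : 'I_d, (i < p)%N -> c i = (i.+1 %% p)%N :> nat.
Hypothesis c_ge : forall i : 'I_d, (p <= i)%N -> c i = i.
Local Notation N := (sdim m n d).
Local Notation S := (@inSchur F m n d).
Local Notation pmx := (pmx F m n).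
Local Notation cycmx := (cycmx F m n c).
Local Notation ymx := (ymx F m n p c).
Implicit Types (s t : 'S_d).

Let p_pr : prime p. Proof. exact: p_prime p_char. Qed.
Let d_gt0 : (0 < d)%N. Proof. lia. Qed.
Let i0 : 'I_d := Ordinal d_gt0.
Let i0_lt : (i0 < p)%N. Proof. by rewrite /=; lia. Qed.

Definition alt_set := [set s : 'S_d |
  [forall i : 'I_d, (p <= i)%N ==> (s i == i)] && ~~ odd_perm s].

Lemma alt_setP s :
  reflect (supported p s /\ odd_perm s = false) (s \in alt_set).
Proof.
rewrite inE; apply: (iffP andP) => [[sS /negbTE os]|[sS ->]]; split=> //.
- by move=> i ip; have /forallP/(_ i) := sS; rewrite ip => /eqP.
- by apply/forallP => i; apply/implyP=> /sS ->.
Qed.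

Lemma alt_group_set : group_set alt_set.
Proof.
apply/group_setP; split.
  by apply/alt_setP; split=> [i _|]; rewrite ?perm1 ?odd_perm1.
move=> s t /alt_setP[sS os] /alt_setP[tS ot]; apply/alt_setP.
by split; [apply: supportedM | rewrite odd_permM os ot].
Qed.
Canonical alt := Group alt_group_set.

Definition fix0_set := [set s : 'S_d |
  [forall i : 'I_d, (i == 0 :> nat) ==> (s i == i)]].

Lemma fix0E s (i : 'I_d) : i = 0 :> nat -> (s \in fix0_set) = (s i == i).
Proof.
move=> i_0; rewrite inE; apply/forallP/eqP => [/(_ i)|si j].
  by rewrite i_0 => /eqP.
by apply/implyP=> /eqP j_0; rewrite -(_ : i = j) ?si //; apply/val_inj; rewrite /= j_0.
Qed.

Lemma fix0_group_set : group_set fix0_set.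
Proof.
apply/group_setP; split.
  by rewrite inE; apply/forallP => i; rewrite perm1 eqxx implybT.
move=> s t; rewrite !inE => /forallP s0 /forallP t0; apply/forallP => i.
by apply/implyP=> i_0; rewrite permM (eqP (implyP (s0 i) i_0)) (implyP (t0 i)).
Qed.
Canonical fix0 := Group fix0_group_set.

(* The group E: multiplications by the squares of F_p, acting on the places. *)
Definition cgrp := (alt :&: fix0 :&: 'N(<[c]>))%G.

Lemma c_alt : c \in alt.
Proof.
by apply/alt_setP; split=> //; apply: (odd_c p_char p_gt2 c_lt c_ge).
Qed.

Lemma cX_inj j k (i : 'I_d) : (i < p)%N ->
  (c ^+ j)%g i = (c ^+ k)%g i -> (c ^+ j = c ^+ k)%g.
Proof.
move=> ip /(congr1 val); rewrite /= !(cX_lt p_char p_gt2 c_lt) //.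
move/eqP; rewrite eqn_modDl => /eqP e.
have cmod l : (c ^+ (l %% p) = c ^+ l)%g.
  by rewrite expg_mod // (cXp p_char p_gt2 c_lt c_ge).
by rewrite -(cmod j) -(cmod k) e.
Qed.

(** Since [s] conjugates c to some c^a and fixes place 0, it sends i = c^i(0) to c^(ai)(0). If p
    divided a, places 0 and 1 would have the same image. *)
Lemma cgrp_act s : s \in cgrp -> exists2 a : nat, coprime a p &
  (forall k, c ^+ k * s = s * c ^+ (a * k))%g /\
  forall i : 'I_d, (i < p)%N -> s i = ((a * i) %% p)%N :> nat.
Proof.
case/setIP=> /setIP[/alt_setP[sS _]]; rewrite (@fix0E _ i0) // => /eqP s0 Ns.
have /cycleP[a ca] : (c ^ s)%g \in <[c]>%g by rewrite memJ_norm // cycle_id.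
have com k : (c ^+ k * s = s * c ^+ (a * k))%g.
  by rewrite expgM -ca -conjXg conjgE mulgA mulgA mulgV mul1g.
have act (i : 'I_d) : (i < p)%N -> s i = ((a * i) %% p)%N :> nat.
  move=> ip; have iE : i = (c ^+ i)%g i0.
    by apply/val_inj; rewrite /= (cX_lt p_char p_gt2 c_lt) // add0n modn_small.
  by rewrite {1}iE -permM com permM s0 (cX_lt p_char p_gt2 c_lt).
exists a => //; rewrite coprime_sym prime_coprime //; apply/negP => pa.
have lt1 : (1 < d)%N by lia.
have := act (Ordinal lt1); rewrite muln1 /= (eqP pa) => /(_ (ltnW p_gt2)) s1.
have /perm_inj/(congr1 val) : s (Ordinal lt1) = s i0.
  by rewrite s0; apply/val_inj.
by [].
Qed.

(** An element of E is determined by the image of place 1, one of the p-1 nonzero places of the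
    block, so E has order less than p. *)
Lemma cgrp_card : #|cgrp|%:R != 0 :> F.
Proof.
have lt1 : (1 < d)%N by lia.
pose i1 := Ordinal lt1; pose B := [set widen_ord le_pd x | x in [set: 'I_p]].
rewrite (natr_eq0 p_char) gtnNdvd ?cardG_gt0 //.
have inj1 : {in cgrp &, injective (fun s : 'S_d => s i1)}.
  move=> s t sG tG /(congr1 val) /=.
  have [a _ [_ sa]] := cgrp_act sG; have [b _ [_ tb]] := cgrp_act tG.
  rewrite sa ?tb ?muln1 //=; try lia; move=> ab; apply/permP => i.
  case: (ltnP i p) => ip; last first.
    case/setIP: sG => /setIP[/alt_setP[-> // _]].
    by case/setIP: tG => /setIP[/alt_setP[-> // _]].
  by apply/val_inj; rewrite /= sa ?tb // -modnMml ab modnMml.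
rewrite -(card_in_imset inj1).
have i0B : i0 \in B.
  have p0 : (0 < p)%N by lia.
  by apply/imsetP; exists (Ordinal p0) => //; apply/val_inj.
apply: (@leq_ltn_trans #|B :\ i0|); last first.
  have := cardsD1 i0 B; rewrite i0B add1n => <-.
  by apply: leq_trans (leq_imset_card _ _) _; rewrite cardsT card_ord.
apply/subset_leq_card/subsetP => _ /imsetP[s sG ->]; rewrite 2!inE.
have sG' := sG; case/setIP: sG' => /setIP[/alt_setP[sS _]].
rewrite (@fix0E _ i0) // => /eqP s0 _; apply/andP; split.
  by rewrite -[X in _ != X]s0 (inj_eq perm_inj).
have i1p : (i1 < p)%N by rewrite /=; lia.
by apply/imsetP; exists (Ordinal (supported_lt sS i1p)) => //; apply/val_inj.
Qed.

(* Zolotarev: multiplication by a on F_p has sign a^((p-1)/2); both sides come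
   from permuting the factors of the Vandermonde product of 0, ..., p-1. *)
Lemma zolotarev s a : s \in cgrp ->
    (forall i : 'I_d, (i < p)%N -> s i = ((a * i) %% p)%N :> nat) ->
  a%:R ^+ h = 1 :> F.
Proof.
case/setIP=> /setIP[/alt_setP[sS os] _ _] act.
(* The Vandermonde factor, larger index minus smaller, made symmetric so that [prod_pairs_perm]
   applies. *)
pose g (i j : 'I_d) : F := if (i < p)%N && (j < p)%N then
  if (i < j)%N then j%:R - i%:R else i%:R - j%:R else 1.
have gC i j : g i j = g j i.
  rewrite /g andbC; case: ifP => // _.
  by case: (ltngtP i j) => // ->.
pose V := \prod_(q : 'I_d * 'I_d | (q.1 < q.2)%N) g q.1 q.2.
have V0 : V != 0.
  apply/prodf_neq0 => -[i j] /= ij; rewrite /g ij; case: ifP => [/andP[ip jp]|_].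
    rewrite -natrB ?(ltnW ij) // (natr_eq0 p_char) gtnNdvd ?subn_gt0 //; lia.
  exact: oner_neq0.
have sgn1 : invsign F s = 1 by rewrite invsignE os.
have := prod_pairs_perm s gC; rewrite -/V => VE.
(* Each pair of the block contributes a factor a, and a sign exactly when [s] inverts it. *)
have VE' : V = invsign F s *
    (\prod_(q : 'I_d * 'I_d | (q.1 < q.2)%N) (if (q.2 < p)%N then a%:R else 1)) * V.
  rewrite -{1}VE /invsign /V -!big_split /=; apply: eq_bigr => -[i j] /= ij.
  rewrite /g /inverted ij; case: (ltnP j p) => jp; last first.
    have jpF : (j < p)%N = false by lia.
    rewrite andbF !mulr1 (sS j) // jpF andbF.
    case: (ltnP i p) => ip; last by rewrite sS ?ij.
    by rewrite (leq_trans (supported_lt sS ip) jp).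
  have ip : (i < p)%N by apply: ltn_trans jp.
  rewrite ip (supported_lt sS ip) (supported_lt sS jp) /=.
  have tE (k : 'I_d) : (k < p)%N -> (s k)%:R = a%:R * k%:R :> F.
    by move=> kp; rewrite act // (GRing.natr_mod_pchar p_char) natrM.
  by case: ifP => _; rewrite (tE i ip) (tE j jp); ring.
move: VE'; rewrite sgn1 mul1r -[LHS]mul1r => /(mulIf V0) prod1; rewrite [RHS]prod1.
(* The block has p(p-1)/2 = ph pairs, and a^(ph) = a^h by Frobenius. *)
transitivity (\prod_(j < d) \prod_(i < d | (i < j)%N)
   (if (j < p)%N then a%:R else 1 : F)).
  rewrite (eq_bigr (fun j : 'I_d => if (j < p)%N then (a%:R : F) ^+ j else 1)).
    rewrite -big_mkcond -(big_ord_widen _ (fun j => (a%:R : F) ^+ j) le_pd).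
    rewrite -expr_sum -(big_mkord xpredT id) bin2_sum bin2 -hp.
    have -> : ((p * h.*2)./2 = p * h)%N by lia.
    by rewrite exprM (natr_expp p_char).
  move=> j _; case: ifP => _; last by rewrite big1.
  rewrite -(big_ord_widen _ (fun=> a%:R : F) (ltnW (ltn_ord j))).
  by rewrite prodr_const card_ord.
by rewrite (exchange_big_dep xpredT) //= pair_big_dep.
Qed.

(** Conjugation by [s] multiplies the exponents of c by a, which changes the coefficients by a^k;
    this is 1 trivially for k = 0 and by [zolotarev] for k = h. *)
Lemma ymx_cgrp (k : nat) s : k = 0%N \/ k = h -> s \in cgrp ->
  ymx k *m pmx s = pmx s *m ymx k.
Proof.
move=> kh sG; have [a co [com act]] := cgrp_act sG.
have ak : a%:R ^+ k = 1 :> F.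
  by case: kh => ->; rewrite ?expr0 ?(zolotarev sG act).
pose G i := ((i%:R : F) ^+ k) *: cycmx i.
have Gp i : G (i + p)%N = G i.
  by rewrite /G (natr_per p_char) (cycmx_per _ _ p_char p_gt2 c_lt c_ge).
rewrite [in RHS](_ : ymx k = \sum_(i < p) G i) // -(sum_periodicM Gp co).
rewrite mulmx_sumr mulmx_suml; apply: eq_bigr => i _; rewrite /G /cycmx natrM exprMn ak.
by rewrite mul1r -scalemxAl -scalemxAr -!pmxM com.
Qed.

Definition avg : 'M[F]_N := #|cgrp|%:R^-1 *: \sum_(s in cgrp) pmx s.

Lemma avg_pmx s : s \in cgrp -> avg *m pmx s = avg.
Proof.
move=> sG; rewrite -scalemxAl mulmx_suml; congr (_ *: _).
rewrite [RHS](reindex_inj (mulIg s)) /=.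
by apply: eq_big => [t|t _]; rewrite ?groupMr ?pmxM.
Qed.

Lemma mulmx_avg k (w : 'M_(k, N)) :
  (forall s, s \in cgrp -> w *m pmx s = w) -> w *m avg = w.
Proof.
move=> wG; rewrite -scalemxAr mulmx_sumr (eq_bigr (fun=> w)) //.
by rewrite sumr_const -scaler_nat scalerA mulVf ?scale1r ?cgrp_card.
Qed.

Lemma avg_comm (A : 'M[F]_N) :
  (forall s, s \in cgrp -> A *m pmx s = pmx s *m A) -> A *m avg = avg *m A.
Proof.
move=> AG; rewrite -scalemxAr -scalemxAl mulmx_sumr mulmx_suml.
by congr (_ *: _); apply: eq_bigr.
Qed.

Lemma cgrp_cinv s k (w : 'M_(k, N)) : s \in cgrp ->
  (forall i, w *m cycmx i = w) -> w *m pmx s *m cycmx 1 = w *m pmx s.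
Proof.
move=> sG wc; have [a _ [com _]] := cgrp_act (groupVr sG).
rewrite -mulmxA -pmxM; have -> : (s * c ^+ 1 = c ^+ (a * 1) * s)%g.
  have e := com 1%N; apply: (mulgI s^-1%g); rewrite !mulgA mulVg mul1g.
  by rewrite -e -mulgA mulVg mulg1.
by rewrite pmxM mulmxA wc.
Qed.

Lemma avg_cinv (w : 'rV_N) : w *m cycmx 1 = w -> w *m avg *m cycmx 1 = w *m avg.
Proof.
move=> wc; rewrite -scalemxAr -scalemxAl mulmx_sumr mulmx_suml; congr (_ *: _).
by apply: eq_bigr => s sG; apply: cgrp_cinv => // i; apply: cycmxX.
Qed.

End Frobenius.

(** * The periodic resolution *)

Section PeriodicResolution.
Variables (F : fieldType) (m n d p h : nat).
Hypotheses (p_char : p \in [pchar F]) (p_gt2 : (2 < p)%N) (hp : h.*2 = p.-1).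
Hypotheses (le_pd : (p <= d)%N) (le_dm : (d <= m)%N) (le_dn : (d <= n)%N).
Variable c : 'S_d.
Hypothesis c_lt : forall i : 'I_d, (i < p)%N -> c i = (i.+1 %% p)%N :> nat.
Hypothesis c_ge : forall i : 'I_d, (p <= i)%N -> c i = i.
Local Notation N := (sdim m n d).
Local Notation S := (@inSchur F m n d).
Local Notation word := (sword m n d).
Local Notation pmx := (pmx F m n).
Local Notation ev := (@ev F m n d).
Local Notation cycmx := (cycmx F m n c).
Local Notation ymx := (ymx F m n p c).
Local Notation cproj := (cproj F m n d p).
Local Notation natrep := (@natrep F m n d).
Local Notation cgrp := (cgrp p c).
Local Notation alt := (alt d p).
Local Notation avg := (avg F m n p c).
Implicit Types (x y : word) (s t : 'S_d).

Let p_pr : prime p. Proof. exact: p_prime p_char. Qed.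
Let d_gt0 : (0 < d)%N. Proof. lia. Qed.
Let i0 : 'I_d := Ordinal d_gt0.

Lemma cgrp_comm s : s \in cgrp -> exists b, (s * c = c ^+ b * s)%g.
Proof.
move=> sG.
have [a _ [com _]] := cgrp_act p_char p_gt2 hp le_pd c_lt (groupVr sG).
exists a; have := com 1%N; rewrite muln1 expg1 => e; apply: (mulgI s^-1%g).
by rewrite !mulgA mulVg mul1g -e -mulgA mulVg mulg1.
Qed.

(** * Transfer from <c> to the alternating group of the block *)

Local Notation C := <[c]>%G.

Definition transfer : 'M[F]_N := \sum_(X in rcosets C alt) pmx (repr X).

Lemma transfer_inv k (w : 'M_(k, N)) s : (forall i, w *m cycmx i = w) ->
  s \in alt -> w *m transfer *m pmx s = w *m transfer.
Proof.
move=> wc sA; rewrite mulmx_sumr.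
have Gc a t : a \in C -> w *m pmx (a * t) = w *m pmx t.
  by case/cycleP=> i ->; rewrite pmxM mulmxA -/(cycmx i) wc.
rewrite -[RHS](sum_rcosets_mul (G := fun s => w *m pmx s) sA Gc) mulmx_suml.
by apply: eq_bigr => X _; rewrite pmxM mulmxA.
Qed.

(** The index set need not be a group: c and E generate the group whose invariants are meant. *)
Definition Zinv : 'M[F]_N := semiinv m n (c |: cgrp) (fun=> 1).

Lemma ZinvP k (w : 'M_(k, N)) :
  reflect (w *m cycmx 1 = w /\ forall s, s \in cgrp -> w *m pmx s = w)
          (w <= Zinv)%MS.
Proof.
apply: (iffP (semiinvP _ _ _)) => [wZ|[wc wG] s].
  split=> [|s sG]; first by rewrite /cycmx expg1 wZ ?setU11 ?scale1r.
  by rewrite wZ ?setU1r ?scale1r.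
rewrite scale1r; case/setU1P=> [->|]; last exact: wG.
by rewrite -[c]expg1.
Qed.

Lemma cinvX k (w : 'M_(k, N)) i : w *m cycmx 1 = w -> w *m cycmx i = w.
Proof.
move=> wc; elim: i => [|i IH]; first by rewrite cycmx0 mulmx1.
by rewrite -(addn1 i) cycmxD mulmxA IH.
Qed.

Let rc (X : {set 'S_d}) := (X :* c)%g.

Let rc_inj : injective rc. Proof. exact: (can_inj (rcosetK c)). Qed.

Let c_alt := c_alt p_char p_gt2 c_lt c_ge.

Let rc_rcosets X : (rc X \in rcosets C alt) = (X \in rcosets C alt).
Proof.
apply/rcosetsP/rcosetsP => [[s sA Xt]|[s sA ->]].
  exists (s * c^-1)%g; first by rewrite groupM ?groupV ?c_alt.
  by rewrite rcosetM -Xt /rc -rcosetM mulgV mulg1.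
by exists (s * c)%g; rewrite ?groupM ?c_alt // /rc rcosetM.
Qed.

Let iter_rc i X : iter i rc X = (X :* (c ^+ i))%g.
Proof.
elim: i => [|i IH]; first by rewrite expg0 mulg1.
by rewrite iterS IH /rc -rcosetM expgSr.
Qed.

(** A representative of a coset fixed by c normalizes <c>, and a power of c on its left makes it fix
    place 0; it then lies in E. *)
Lemma rcosets_fixed X : (X \in rcosets C alt) && (rc X == X) =
  (X \in [set (C :* s)%g | s in cgrp]).
Proof.
apply/andP/imsetP => [[/rcosetsP[s sA ->] /eqP Xc]|[s sG ->]]; last first.
  have /setIP[/setIP[sA _] _] := sG.
  split; first by apply/rcosetsP; exists s.
  have [b scb] := cgrp_comm sG; rewrite /rc -rcosetM scb rcosetM.
  by rewrite (rcoset_id (mem_cycle c b)).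
have /alt_setP[sS _] := sA.
pose j := (s^-1)%g i0; pose t := (c ^+ j * s)%g.
have ip : (i0 < p)%N by rewrite /=; lia.
have t0 : t i0 = i0.
  rewrite permM (_ : (c ^+ j)%g i0 = j) ?permKV //.
  apply/val_inj; rewrite /= (cX_lt p_char p_gt2 c_lt) // add0n modn_small //.
  by apply: supported_lt => //; apply: supportedV.
have tA : t \in alt by rewrite /t groupM // groupX // c_alt.
have Ct : (C :* t = C :* s)%g by rewrite /t rcosetM (rcoset_id (mem_cycle c j)).
exists t => //; rewrite 2!in_setI tA (fix0E _ (i := i0)) // t0 eqxx /=.
have := rcoset_refl C (t * c)%g; rewrite rcosetM -/(rc _) Ct Xc -Ct.
rewrite mem_rcoset => tct; rewrite -groupV -cycle_subG norms_cycle.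
by rewrite conjgE invgK mulgA.
Qed.

Definition transfer_rest : 'M[F]_N :=
  \sum_(X | (X \in rcosets C alt) && (rc X != X) && (froot rc X == X)) pmx (repr X).

(** A Mackey formula: each coset fixed by c contributes [w], and there are as many as elements of E;
    each free orbit of cosets contributes an image of the norm. *)
Lemma transfer_decomp k (w : 'M_(k, N)) : (w <= Zinv)%MS ->
  w *m transfer = #|cgrp|%:R *: w + w *m transfer_rest *m ymx 0.
Proof.
case/ZinvP=> wc wG; have wcX i := cinvX i wc.
pose G X := w *m pmx (repr X).
have Grep s : G (C :* s)%g = w *m pmx s.
  rewrite /G; have [a /cycleP[i ->] ->] := rcosetP (mem_repr_rcoset C s).
  by rewrite pmxM mulmxA -/(cycmx i) wcX.
have Gc X : X \in rcosets C alt -> G (rc X) = G X *m cycmx 1.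
  case/rcosetsP=> s _ ->; rewrite /rc -rcosetM !Grep pmxM mulmxA.
  by rewrite /cycmx expg1.
have Giter i X : X \in rcosets C alt -> G (iter i rc X) = G X *m cycmx i.
  move=> XR; elim: i => [|i IH]; first by rewrite cycmx0 mulmx1.
  rewrite iterS Gc ?IH -?mulmxA -?cycmxD ?addn1 //.
  by elim: i {IH} => //= i; rewrite rc_rcosets.
rewrite mulmx_sumr (bigID (fun X => rc X == X)) /=; congr (_ + _).
  rewrite (eq_bigl _ _ rcosets_fixed) big_imset /=.
    rewrite (eq_bigr (fun=> w)) => [|s sG]; last by rewrite -/(G _) Grep wG.
    by rewrite sumr_const scaler_nat.
  move=> s t sG tG e.
  have /setIP[/setIP[_]] := sG; rewrite (fix0E _ (i := i0)) // => /eqP s0 _.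
  have /setIP[/setIP[_]] := tG; rewrite (fix0E _ (i := i0)) // => /eqP t0 _.
  have := rcoset_refl C s; rewrite e mem_rcoset => /cycleP[j sj].
  have sE : s = (c ^+ j * t)%g by rewrite -sj mulgKV.
  have : (c ^+ j)%g i0 = (c ^+ 0)%g i0.
    apply: (@perm_inj _ t); rewrite -permM -sE expg0 perm1.
    by rewrite s0 t0.
  have ip : (i0 < p)%N by rewrite /=; lia.
  by move/(cX_inj p_char p_gt2 c_lt c_ge ip) => cj; rewrite sE cj expg0 mul1g.
rewrite (@sum_free_orbits _ rc p _ rc_inj p_pr) //.
- rewrite [w *m transfer_rest]mulmx_sumr mulmx_suml.
  apply: eq_bigr => X /andP[/andP[XR _] _].
  rewrite mulmx_sumr; apply: eq_bigr => i _.
  by rewrite -/(G _) Giter // expr0 scale1r.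
- by move=> X; rewrite rc_rcosets (inj_eq rc_inj).
- by move=> X _; rewrite iter_rc (cXp p_char p_gt2 c_lt c_ge) mulg1.
- by move=> X /andP[].
Qed.

(** * Words with prescribed stabilizers *)

Definition evenL (i : 'I_d) : 'I_(m + n) := lshift n (widen_ord le_dm i).
Definition oddL (i : 'I_d) : 'I_(m + n) := rshift m (widen_ord le_dn i).

Lemma evenL_inj : injective evenL.
Proof. by move=> i j /lshift_inj /(congr1 val) /= /val_inj. Qed.

Lemma odd_evenL i : odd_idx (evenL i) = false.
Proof. by rewrite /odd_idx leqNgt /=; have := ltn_ord i; lia. Qed.

Lemma odd_oddL i : odd_idx (oddL i).
Proof. by rewrite /odd_idx leq_addr. Qed.

Definition block_word (a : 'I_(m + n)) : word :=
  [ffun i : 'I_d => if (i < p)%N then a else evenL i].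

Lemma supported_group_set :
  group_set [set s : 'S_d | [forall i : 'I_d, (p <= i)%N ==> (s i == i)]].
Proof.
have suppP s : reflect (supported p s)
    (s \in [set s : 'S_d | [forall i : 'I_d, (p <= i)%N ==> (s i == i)]]).
  rewrite inE; apply: (iffP forallP) => [sS i ip|sS i].
    by have := sS i; rewrite ip => /eqP.
  by apply/implyP=> /sS ->.
apply/group_setP; split; first by apply/suppP => i _; rewrite perm1.
by move=> s t /suppP sS /suppP tS; apply/suppP; apply: supportedM.
Qed.
Definition supported_group := Group supported_group_set.

Lemma supported_groupP s : reflect (supported p s) (s \in supported_group).
Proof.
rewrite inE; apply: (iffP forallP) => [sS i ip|sS i].
  by have := sS i; rewrite ip => /eqP.
by apply/implyP=> /sS ->.
Qed.

Lemma stab_block_word a s : (forall i : 'I_d, (p <= i)%N -> evenL i != a) ->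
  (wact (block_word a) s == block_word a) = (s \in supported_group).
Proof.
move=> na; apply/eqP/supported_groupP => [xs i ip|sS].
  have ipF : (i < p)%N = false by rewrite ltnNge ip.
  have := congr1 (fun y : word => y i) xs; rewrite !ffunE ipF.
  case: ifP => [_ e|_ /evenL_inj e]; last by rewrite -{1}e permKV.
  by have := na i ip; rewrite e eqxx.
apply/ffunP=> i; rewrite !ffunE; case: (ltnP i p) => ip.
  by rewrite (supported_lt (supportedV sS) ip).
by rewrite (supportedV sS ip) ltnNge ip.
Qed.

(** Its stabilizer is trivial, so W itself is the projective module of this word. *)
Definition distinct_word : word := [ffun i : 'I_d => evenL i].

Lemma stab_distinct_word s :
  (wact distinct_word s == distinct_word) = (s \in [1 'S_d]%G).
Proof.
rewrite inE; apply/eqP/eqP => [xs|->]; last exact: wact1.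
apply/permP => i; have := congr1 (fun y : word => y (s i)) xs.
by rewrite !ffunE permK perm1 => /evenL_inj.
Qed.

(** * The module Q inside W + W and its projectivity *)

Definition rep2 (A : 'M[F]_N) : 'M[F]_(N + N) := block_mx A 0 0 A.

Lemma rep2_smodule : @is_smodule F m n d _ rep2.
Proof.
split=> [A B _ _|a A B _ _|]; rewrite /rep2.
- by rewrite mulmx_block !mul0mx !mulmx0 !addr0 !add0r.
- by rewrite scale_block_mx add_block_mx !scaler0 !addr0.
- by rewrite -scalar_mx_block.
Qed.

Definition Pinv : 'M[F]_N := semiinv m n cgrp (fun=> 1).

Lemma PinvP k (w : 'M_(k, N)) :
  reflect (forall s, s \in cgrp -> w *m pmx s = w) (w <= Pinv)%MS.
Proof.
apply: (iffP (semiinvP _ _ _)) => wP s sG; first by rewrite wP ?scale1r.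
by rewrite wP ?scale1r.
Qed.

Definition Qspace : 'M[F]_(N + N) := block_mx Pinv 0 0 Zinv.

Lemma QspaceP k (v w : 'M_(k, N)) :
  reflect ((v <= Pinv)%MS /\ (w <= Zinv)%MS) (row_mx v w <= Qspace)%MS.
Proof.
apply: (iffP idP) => [/submxP[X]|[/submxP[X ->] /submxP[Y ->]]].
  rewrite -[X]hsubmxK mul_row_block !mulmx0 addr0 add0r => /eq_row_mx[-> ->].
  by rewrite !submxMl.
apply/submxP; exists (row_mx X Y).
by rewrite mul_row_block !mulmx0 addr0 add0r.
Qed.

Lemma Qspace_sstable : @sstable F m n d _ _ rep2 Qspace.
Proof.
move=> A SA; rewrite /rep2 mulmx_block !mulmx0 !mul0mx !addr0 !add0r.
rewrite block_mxEv col_mx_sub; apply/andP; split; apply/QspaceP.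
  by rewrite sub0mx; split=> //; apply: semiinv_sstable.
by rewrite sub0mx; split=> //; apply: semiinv_sstable.
Qed.

Definition Qrep := @subrep F m n d _ _ rep2 Qspace.
Local Notation iQ := (row_base Qspace).

Lemma Qrep_smodule : is_smodule Qrep.
Proof. exact: subrep_smodule rep2_smodule Qspace_sstable. Qed.

Let iQP : (lsubmx iQ <= Pinv)%MS /\ (rsubmx iQ <= Zinv)%MS.
Proof. by apply/QspaceP; rewrite hsubmxK eq_row_base. Qed.

Lemma liftable_via (H : {group 'S_d}) x (a : 'M_(N + N, N)) (b : 'M_(N, N + N)) :
    (forall s, (wact x s == x) = (s \in H)) ->
    is_shom rep2 natrep a -> is_shom natrep rep2 b ->
    (iQ *m a <= semiinv m n H (wsign F x))%MS ->
    (semiinv m n H (wsign F x) *m b <= Qspace)%MS ->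
  exists2 f, liftable Qrep Qrep f & f *m iQ = iQ *m a *m b.
Proof.
move=> stabx Ha Hb aU bU; set U := semiinv m n H (wsign F x).
have HiQ := shom_row_base Qspace_sstable.
have stU := @semiinv_sstable F m n d H (wsign F x).
have [f Hf fE] := shom_corestr stU (shomM HiQ Ha) aU.
have bU' : (row_base U *m b <= Qspace)%MS.
  by apply: submx_trans bU; rewrite submxMr ?eq_row_base.
have [g Hg gE] := shom_corestr Qspace_sstable (shomM (shom_row_base stU) Hb) bU'.
exists (f *m g); last by rewrite -mulmxA gE mulmxA fE.
exact: liftable_factor (semiinv_sproj stabx) Hf Hg.
Qed.

Lemma shom_col_mx (A B : 'M[F]_N) : is_shom natrep natrep A ->
  is_shom natrep natrep B -> is_shom rep2 natrep (col_mx A B).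
Proof.
move=> HA HB X SX; rewrite /rep2 mul_block_col !mul0mx addr0 add0r.
by rewrite mul_col_mx HA ?HB.
Qed.

Lemma shom_row_mx (A B : 'M[F]_N) : is_shom natrep natrep A ->
  is_shom natrep natrep B -> is_shom natrep rep2 (row_mx A B).
Proof.
move=> HA HB X SX; rewrite /rep2 mul_row_block !mulmx0 addr0 add0r.
by rewrite mul_mx_row HA ?HB.
Qed.

Lemma shom_pmx s : is_shom natrep natrep (pmx s).
Proof. by move=> X SX; rewrite inSchur_pmx. Qed.

Lemma shom_sum (I : finType) (P : pred I) r1 r2 (rho1 : 'M[F]_N -> 'M_r1)
    (rho2 : 'M[F]_N -> 'M_r2) (G : I -> 'M_(r1, r2)) :
    (forall i, P i -> is_shom rho1 rho2 (G i)) ->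
  is_shom rho1 rho2 (\sum_(i | P i) G i).
Proof.
move=> HG X SX; rewrite mulmx_sumr mulmx_suml.
by apply: eq_bigr => i Pi; apply: HG.
Qed.

Lemma shom_ymx (k : nat) : is_shom natrep natrep (ymx k).
Proof. by apply: shom_sum => i _; apply/shomZ/shom_pmx. Qed.

Lemma shom_avg : is_shom natrep natrep avg.
Proof. by apply/shomZ/shom_sum => s _; apply: shom_pmx. Qed.

Lemma shom_transfer : is_shom natrep natrep transfer.
Proof. by apply: shom_sum => s _; apply: shom_pmx. Qed.

Lemma shom_transfer_rest : is_shom natrep natrep transfer_rest.
Proof. by apply: shom_sum => s _; apply: shom_pmx. Qed.

Let cardG0 : #|cgrp|%:R != 0 :> F.
Proof. exact (cgrp_card p_char p_gt2 hp le_pd c_lt). Qed.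

Lemma avg_Pinv k (A : 'M_(k, N)) : (A *m avg <= Pinv)%MS.
Proof. by apply/PinvP => s sG; rewrite -mulmxA avg_pmx. Qed.

Lemma ymx0_avg_Zinv k (A : 'M_(k, N)) : (A *m ymx 0 *m avg <= Zinv)%MS.
Proof.
apply/ZinvP; split; last by move=> s sG; rewrite -mulmxA avg_pmx.
rewrite -(mulmxA A) avg_comm => [|s sG]; last first.
  by rewrite (ymx_cgrp m n p_char p_gt2 hp le_pd c_lt c_ge _ sG) //; left.
by rewrite !mulmxA -mulmxA (ymx_cycmx0 m n p_char p_gt2 c_lt c_ge).
Qed.

Let two_neq0 : 2%:R != 0 :> F.
Proof. by rewrite (natr_eq0 p_char) gtnNdvd. Qed.

Lemma alt_supported s : s \in alt -> s \in supported_group.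
Proof. by case/alt_setP=> sS _; apply/supported_groupP. Qed.

Lemma cgrp_alt s : s \in cgrp -> s \in alt.
Proof. by case/setIP=> /setIP[]. Qed.

Lemma Zinv_alt k (w : 'M_(k, N)) :
  (forall s, s \in alt -> w *m pmx s = w) -> (w <= Zinv)%MS.
Proof.
move=> wA; apply/ZinvP; split; last by move=> s /cgrp_alt/wA.
by rewrite /cycmx expg1 wA ?c_alt.
Qed.

Let p_gt1_d : (1 < d)%N. Proof. lia. Qed.
Let i1 : 'I_d := Ordinal p_gt1_d.
Let tau : 'S_d := tperm i0 i1.

Let tau_supp : tau \in supported_group.
Proof.
apply/supported_groupP => i ip; rewrite /tau tpermD //.
  by rewrite -val_eqE /=; lia.
by rewrite -val_eqE /=; lia.
Qed.

Let odd_tau : odd_perm tau.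
Proof. by rewrite odd_tperm. Qed.

(** Modulo the alternating group only the transposition [tau] acts on [w]; adding or subtracting
    [w *m pmx tau] gives an invariant or an anti-invariant. *)
Lemma supported_semiinv (b : bool) k (w : 'M_(k, N)) :
    (forall s, s \in alt -> w *m pmx s = w) ->
  forall s, s \in supported_group ->
  (w + (-1) ^+ b *: (w *m pmx tau)) *m pmx s
    = (-1) ^+ (b && odd_perm s) *: (w + (-1) ^+ b *: (w *m pmx tau)).
Proof.
move=> wA s sS; have suppA t : t \in supported_group -> odd_perm t = false ->
    w *m pmx t = w.
  by move=> /supported_groupP tS ot; apply: wA; apply/alt_setP.
have tt : (tau * tau = 1)%g by rewrite /tau tperm2.
rewrite mulmxDl -scalemxAl -mulmxA -pmxM.
case os: (odd_perm s); last first.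
  rewrite andbF scale1r suppA //; congr (_ + _ *: _).
  have -> : (tau * s = tau * s * tau * tau)%g by rewrite -mulgA tt mulg1.
  rewrite pmxM mulmxA suppA //; first by rewrite !groupM.
  by rewrite !odd_permM os odd_tau.
rewrite andbT (suppA (tau * s)%g) ?groupM ?odd_permM ?os ?odd_tau //.
have -> : (s = s * tau * tau)%g by rewrite -mulgA tt mulg1.
rewrite pmxM mulmxA suppA ?groupM ?odd_permM ?os ?odd_tau // scalerDr scalerA.
by rewrite -signr_addb addbb scale1r addrC.
Qed.

(** A block of one repeated even letter realizes the trivial character of Sym_p, one of a repeated
    odd letter the sign character. *)
Definition sym_word (b : bool) := block_word (if b then oddL i0 else evenL i0).

Lemma stab_sym_word b s :
  (wact (sym_word b) s == sym_word b) = (s \in supported_group).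
Proof.
apply: stab_block_word => i ip; case: b.
  by rewrite /evenL /oddL eq_lrshift.
by apply/eqP => /evenL_inj e; rewrite e /= in ip; lia.
Qed.

Lemma wsign_sym_word b s : s \in supported_group ->
  wsign F (sym_word b) s = (-1) ^+ (b && odd_perm s).
Proof.
move=> /supported_groupP sS; rewrite (wsign_supported F sS (b := b)).
  by case: b; rewrite // invsignE.
by move=> i ip; rewrite ffunE ip; case: b; rewrite ?odd_oddL ?odd_evenL.
Qed.

Lemma sym_semiinv_sub b :
  (semiinv m n supported_group (wsign F (sym_word b)) <= Zinv)%MS.
Proof.
apply: Zinv_alt => s sA; have sS := alt_supported sA.
have /semiinvP -> // := submx_refl (semiinv m n supported_group (wsign F (sym_word b))).
by case/alt_setP: sA => _ os; rewrite wsign_sym_word // os andbF scale1r.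
Qed.

Lemma distinct_semiinv k (w : 'M_(k, N)) :
  (w <= semiinv m n [1 'S_d]%G (wsign F distinct_word))%MS.
Proof.
by apply/semiinvP => s; rewrite inE => /eqP ->; rewrite pmx1 mulmx1 wsign1 scale1r.
Qed.

Lemma Qrep_sproj : is_sproj Qrep.
Proof.
have [iQ1 iQ2] := iQP.
have H0 := @shom0 F m n d N N natrep natrep.
have H1 := @shom1 F m n d N natrep.
(* [f1] is the projection of Q onto P, which factors through W because averaging over E retracts W
   onto P. *)
pose a1 := col_mx 1%:M 0 : 'M[F]_(N + N, N); pose b1 := row_mx avg 0 : 'M[F]_(N, N + N).
have [f1 Lf1 f1E] : exists2 f, liftable Qrep Qrep f & f *m iQ = iQ *m a1 *m b1.
  apply: (liftable_via stab_distinct_word).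
  - exact: shom_col_mx.
  - exact: shom_row_mx shom_avg H0.
  - exact: distinct_semiinv.
  - rewrite mul_mx_row mulmx0; apply/QspaceP; rewrite sub0mx.
    by split=> //; apply: avg_Pinv.
(* [f4] removes the free-orbit part of [transfer_decomp] and factors through W. *)
pose a4 := col_mx 0 transfer_rest : 'M[F]_(N + N, N).
pose b4 := row_mx 0 (- #|cgrp|%:R^-1 *: (ymx 0 *m avg)) : 'M[F]_(N, N + N).
have [f4 Lf4 f4E] : exists2 f, liftable Qrep Qrep f & f *m iQ = iQ *m a4 *m b4.
  apply: (liftable_via stab_distinct_word).
  - exact: shom_col_mx H0 shom_transfer_rest.
  - apply: shom_row_mx H0 _; apply: shomZ; exact: shomM (shom_ymx 0) shom_avg.
  - exact: distinct_semiinv.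
  - rewrite mul_mx_row mulmx0; apply/QspaceP; rewrite sub0mx; split=> //.
    by rewrite -scalemxAr mulmxA scalemx_sub // ymx0_avg_Zinv.
(* The symmetric and antisymmetric parts of the transfer sum to twice the transfer, whence the
   scalar [(2%:R * #|cgrp|%:R)^-1] in [b2]. *)
pose a2 (b : bool) := col_mx 0 (transfer + (-1) ^+ b *: (transfer *m pmx tau))
   : 'M[F]_(N + N, N).
pose b2 := row_mx 0 ((2%:R * #|cgrp|%:R)^-1 *: 1%:M) : 'M[F]_(N, N + N).
have Lf2 b : exists2 f, liftable Qrep Qrep f & f *m iQ = iQ *m a2 b *m b2.
  apply: (liftable_via (stab_sym_word b)).
  - apply: shom_col_mx H0 _; apply: shomD shom_transfer _; apply: shomZ.
    exact: shomM shom_transfer (shom_pmx tau).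
  - by apply: shom_row_mx H0 _; apply: shomZ.
  - rewrite -[iQ]hsubmxK mul_row_col mulmx0 add0r mulmxDr -scalemxAr mulmxA.
    apply/semiinvP => s sS; rewrite wsign_sym_word //.
    apply: supported_semiinv => // t tA; apply: transfer_inv => // i.
    by case/ZinvP: iQ2 => wc _; apply: cinvX.
  - rewrite mul_mx_row mulmx0; apply/QspaceP; rewrite sub0mx; split=> //.
    by rewrite -scalemxAr mulmx1 scalemx_sub // sym_semiinv_sub.
have [f2 Lf20 f2E] := Lf2 false; have [f3 Lf21 f3E] := Lf2 true.
apply: liftable_sproj.
suff -> : 1%:M = f1 + (f2 + f3 + f4) by do !apply: liftableD.
apply: row_baseI; rewrite !mulmxDl mul1mx f1E f2E f3E f4E.
rewrite -[iQ]hsubmxK !mul_row_col !mulmx0 !add0r mulmx1 addr0 !mul_mx_row !mulmx0.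
rewrite !add_row_mx !addr0 !add0r; congr row_mx.
  by rewrite (mulmx_avg p_char p_gt2 hp le_pd c_lt) //; apply/PinvP.
set w := rsubmx iQ.
have wG : w *m avg = w.
  by rewrite (mulmx_avg p_char p_gt2 hp le_pd c_lt) //; case/ZinvP: iQ2.
have := congr1 (fun z : 'M_(_, N) => z *m avg) (transfer_decomp iQ2); rewrite -/w.
rewrite mulmxDl -scalemxAl wG.
have -> : w *m transfer *m avg = w *m transfer.
  rewrite (mulmx_avg p_char p_gt2 hp le_pd c_lt) // => s sG.
  apply: transfer_inv (cgrp_alt sG) => i.
  by case/ZinvP: iQ2 => wc _; apply: cinvX.
rewrite -(mulmxA _ (ymx 0)); move: (ymx 0 *m avg) => Y tE.
rewrite -!scalemxAr !mulmx1 -scalerDr expr0 expr1 scale1r scaleN1r.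
rewrite mulmxDr mulmxBr addrACA subrr addr0 tE; set r := w *m _ *m Y.
have dbl (x : 'M[F]_(\rank Qspace, N)) : x + x = 2%:R *: x by rewrite scaler_nat.
rewrite dbl scalerA invfM mulrAC mulVf // mul1r.
by rewrite scalerDr scalerA mulVf // scale1r scaleNr addrK.
Qed.

(** * The periodic differential on Q *)

Let h_lt : (h < p.-1)%N. Proof. lia. Qed.

Local Notation Y := (ymx h).
Definition dmx : 'M[F]_(N + N) := block_mx Y (- (Y *m Y)) 1%:M (- Y).

Lemma shom_dmx : is_shom rep2 rep2 dmx.
Proof.
move=> A SA; rewrite /rep2 /dmx !mulmx_block !mul0mx !mulmx0 !addr0 !add0r.
have YA := shom_ymx h SA; rewrite /natrep in YA.
by rewrite mul1mx mulmx1 !mulmxN !mulNmx YA mulmxA YA -mulmxA YA mulmxA.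
Qed.

Lemma dmxE k (v w : 'M_(k, N)) :
  row_mx v w *m dmx = row_mx (v *m Y + w) (- ((v *m Y + w) *m Y)).
Proof.
by rewrite mul_row_block mulmx1 !mulmxN mulmxDl -mulmxA -opprD.
Qed.

Lemma ymx_sq_cycmx1 k (v : 'M_(k, N)) : v *m Y *m Y *m cycmx 1 = v *m Y *m Y.
Proof.
have YY : Y *m Y = (- (-1) ^+ h) *: ymx 0.
  have := ymx0_factor m n p_char p_gt2 c_lt c_ge (t := h).
  have {1}-> : (p.-1 - h = h)%N by lia.
  move=> ->; last lia.
  by rewrite scalerA mulrNN -expr2 sqrr_sign scale1r.
rewrite -!(mulmxA v) YY -scalemxAl.
by rewrite (ymx_cycmx0 m n p_char p_gt2 c_lt c_ge).
Qed.

Lemma cinv_ymx0 k (w : 'M_(k, N)) : w *m cycmx 1 = w -> w *m Y = 0.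
Proof.
move=> wc; apply/row_matrixP => i; rewrite row_mul row0.
by apply: (ymx_cinv p_char p_gt2) => //; rewrite -row_mul wc.
Qed.

Lemma ymx_Pinv k (v : 'M_(k, N)) : (v <= Pinv)%MS -> (v *m Y <= Pinv)%MS.
Proof.
move/PinvP=> vP; apply/PinvP => s sG; rewrite -mulmxA.
rewrite (ymx_cgrp m n p_char p_gt2 hp le_pd c_lt c_ge _ sG); last by right.
by rewrite mulmxA vP.
Qed.

Lemma dmx_Qspace k (q : 'M_(k, N + N)) : (q <= Qspace)%MS -> (q *m dmx <= Qspace)%MS.
Proof.
rewrite -[q]hsubmxK dmxE; set v := lsubmx q; set w := rsubmx q.
case/QspaceP=> vP /ZinvP[wc wG]; have wP : (w <= Pinv)%MS by apply/PinvP.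
have uP : ((v *m Y + w)%R <= Pinv)%MS by rewrite addmx_sub // ymx_Pinv.
apply/QspaceP; split=> //; apply/ZinvP; split; last first.
  by apply/PinvP; rewrite eqmx_opp ymx_Pinv.
by rewrite mulmxDl (cinv_ymx0 wc) addr0 mulNmx ymx_sq_cycmx1.
Qed.

Lemma dmx_sq : dmx *m dmx = 0.
Proof.
rewrite -[X in X *m _ = _](submxK dmx) block_mxEv mul_col_mx !dmxE.
rewrite /dmx block_mxKul block_mxKur block_mxKdl block_mxKdr.
by rewrite mul1mx !subrr mul0mx oppr0 row_mx0 col_mx0.
Qed.

Lemma dmx_exact (q : 'rV_(N + N)) : (q <= Qspace)%MS -> q *m dmx = 0 ->
  exists2 q', (q' <= Qspace)%MS & q = q' *m dmx.
Proof.
rewrite -[q]hsubmxK dmxE; set v := lsubmx q; set w := rsubmx q.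
case/QspaceP=> vP /ZinvP[wc wG] /eqP; rewrite row_mx_eq0 => /andP[/eqP vYw _].
have wE : w = - (v *m Y) by apply/eqP; rewrite -addr_eq0 addrC vYw.
have vYc : v *m Y *m cycmx 1 = v *m Y.
  by apply: oppr_inj; rewrite -mulNmx -wE.
have [v' [w' vE w'c]] := ymx_exact p_char p_gt2 c_lt c_ge hp vYc.
(* A kernel element has w = -vY, and [ymx_exact] gives v = v'Y + w' with w' fixed by c. Averaging
   over E, which commutes with Y, puts v' in P and w' in Z. *)
exists (row_mx (v' *m avg) (w' *m avg)).
  apply/QspaceP; split; first exact: avg_Pinv.
  by apply/ZinvP; split; [apply: (avg_cinv p_char p_gt2 hp le_pd c_lt)
                         |move=> s sG; rewrite -mulmxA avg_pmx].
have avgY : avg *m Y = Y *m avg.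
  rewrite avg_comm // => s sG.
  by rewrite (ymx_cgrp m n p_char p_gt2 hp le_pd c_lt c_ge _ sG) //; right.
have vavg : v *m avg = v.
  by rewrite (mulmx_avg p_char p_gt2 hp le_pd c_lt) //; apply/PinvP.
have vE' : v' *m avg *m Y + w' *m avg = v.
  by rewrite -mulmxA avgY mulmxA -mulmxDl -vE vavg.
by rewrite dmxE vE' -wE.
Qed.

(** Since [f] commutes with S, the image of e_y is that of e_x under [wordop (ev y)], a sum over all
    permutations. Its terms followed by [cproj] are unchanged under right multiplication by c, so
    they occur p at a time and cancel. *)
Lemma shom_kill (f : 'M[F]_N) : is_shom natrep natrep f ->
  f *m cycmx 1 = f -> f *m cproj = 0.
Proof.
move=> Hf fc; apply: ev_ext => y; rewrite mulmx0 mulmxA.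
set x := distinct_word; pose q := ev x *m f.
have xU := distinct_semiinv (ev y).
have Sy := wordop_inSchur stab_distinct_word xU.
rewrite -(ev_wordop (H := [1 'S_d]%G) stab_distinct_word (ev y)) -(mulmxA (ev x)).
have := Hf _ Sy; rewrite /natrep => ->; rewrite mulmxA -/q.
pose K s := crd (q *m pmx s^-1) x *: (ev y *m pmx s *m cproj).
have qc : q *m cycmx 1 = q by rewrite /q -mulmxA fc.
have qcV : q *m pmx c^-1 = q.
  by rewrite -{1}qc /cycmx expg1 -mulmxA -pmxM mulgV pmx1 mulmx1.
have Kc s : K (s * c)%g = K s.
  rewrite /K invMg !pmxM !mulmxA qcV -(mulmxA _ (pmx c)).
  by rewrite pmx_cproj //; case/alt_setP: c_alt.
have Kiter i s : K (iter i (mulg^~ c) s) = K s by elim: i => //= i <-.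
transitivity (\sum_s K s).
  rewrite /wordop mulmx_sumr mulmx_suml /rcosets big_imset /=; last first.
    by move=> s t _ _; rewrite !rcosetE !mul1g => /set1_inj.
  rewrite (eq_bigl xpredT) => [|s]; last by rewrite inE.
  apply: eq_bigr => s _; rewrite rcosetE mul1g repr_set1 /wordop_term.
  by rewrite !mulmxA mulmx_evT mul_scalar_mx -!scalemxAl.
rewrite (@sum_free_orbits _ (mulg^~ c) p xpredT) //.
- apply: big1 => s _; rewrite (eq_bigr (fun=> K s)) //.
  by rewrite sumr_const card_ord -scaler_nat (pcharf0 p_char) scale0r.
- exact: mulIg.
- move=> s _; have -> k : iter k (mulg^~ c) s = (s * c ^+ k)%g.
    by elim: k => [|k IH]; rewrite ?expg0 ?mulg1 // iterS IH expgSr mulgA.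
  by rewrite (cXp p_char p_gt2 c_lt c_ge) mulg1.
- move=> s _; rewrite -[X in _ != X]mulg1 (inj_eq (mulgI s)).
  apply/eqP => c1; have ip : (i0 < p)%N by rewrite /=; lia.
  by have := c_lt ip; rewrite c1 perm1 /= modn_small //; lia.
Qed.

Lemma Qrep_differential : exists2 D, is_shom Qrep Qrep D &
  D *m iQ = iQ *m dmx /\ (D == kermx D)%MS.
Proof.
have HiQ := shom_row_base Qspace_sstable.
have iQQ : (iQ <= Qspace)%MS by rewrite eq_row_base.
have [D HD DE] := shom_corestr Qspace_sstable (shomM HiQ shom_dmx) (dmx_Qspace iQQ).
exists D => //; split=> //; apply/andP; split.
  apply/sub_kermxP; apply: row_baseI.
  by rewrite -mulmxA DE mulmxA DE -mulmxA dmx_sq mulmx0 mul0mx.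
apply/row_subP => i; set q := row i _.
have qD : q *m D = 0 by rewrite /q -row_mul mulmx_ker row0.
have qQ : (q *m iQ <= Qspace)%MS by apply: submx_trans (submxMl _ _) iQQ.
have [|q' q'Q qE] := dmx_exact qQ; first by rewrite -mulmxA -DE mulmxA qD mul0mx.
have /submxP[r rE] : (q' <= iQ)%MS by rewrite eq_row_base.
apply/submxP; exists r; apply: row_baseI.
by rewrite qE rE -(mulmxA r iQ) -DE mulmxA.
Qed.

Let iQ_snd : rsubmx iQ *m cycmx 1 = rsubmx iQ.
Proof. by case: iQP => _ /ZinvP[]. Qed.

Lemma Qrep_nonsplit D K : is_shom Qrep Qrep D -> is_shom Qrep Qrep K ->
  D *m iQ = iQ *m dmx -> (D == kermx D)%MS -> D <> D *m K *m D.
Proof.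
move=> HD HK DE /andP[_ kerD] DKD.
have HiQ := shom_row_base Qspace_sstable.
pose pr2 : 'M[F]_(N + N, N) := col_mx 0 1%:M.
have iQ2 : iQ *m pr2 = rsubmx iQ.
  by rewrite -{1}[iQ]hsubmxK mul_row_col mulmx0 add0r mulmx1.
have H0 := @shom0 F m n d N N natrep natrep.
have H1 := @shom1 F m n d N natrep.
have Hpr2 : is_shom rep2 natrep pr2 by apply: shom_col_mx.
have kill (e : 'M_(N, \rank Qspace)) : is_shom natrep Qrep e ->
    e *m K *m iQ *m pr2 *m cproj = 0.
  move=> He; apply: shom_kill; first exact: shomM (shomM (shomM He HK) HiQ) Hpr2.
  by rewrite -(mulmxA _ iQ) iQ2 -mulmxA iQ_snd.
(* [e1] and [e2] map W onto P and into Z; their images together contain im D. *)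
have [e1 He1 e1E] : exists2 e, is_shom natrep Qrep e & e *m iQ = row_mx avg 0.
  apply: (shom_corestr Qspace_sstable); first exact: shom_row_mx shom_avg H0.
  apply/QspaceP; rewrite sub0mx; split=> //.
  by rewrite -[X in (X <= _)%MS]mul1mx avg_Pinv.
have [e2 He2 e2E] : exists2 e, is_shom natrep Qrep e &
    e *m iQ = row_mx 0 (ymx 0 *m avg).
  apply: (shom_corestr Qspace_sstable).
    by apply: shom_row_mx H0 _; apply: shomM (shom_ymx 0) shom_avg.
  apply/QspaceP; rewrite sub0mx; split=> //.
  by rewrite -[X in (X *m _ <= _)%MS]mul1mx ymx0_avg_Zinv.
have DKpr (q : 'rV_(\rank Qspace)) : q *m D *m K *m iQ *m pr2 *m cproj = 0.
  have qQ : (q *m iQ <= Qspace)%MS.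
    by apply: submx_trans (submxMl _ _) _; rewrite eq_row_base.
  have := dmx_Qspace qQ; rewrite -{1}[q *m iQ]hsubmxK dmxE.
  (* The image of q under D is (u, -uY), where -uY is fixed by c and has no constant component,
     hence is a norm. So it is reached from W by [e1] and [e2]. *)
  set u := _ *m Y + _ => /QspaceP[/PinvP uP /ZinvP[uYc uYG]].
  have [z zE] := cinv_decomp p_char p_gt2 c_lt c_ge uYc.
  rewrite mulNmx -(mulmxA u) (ymx_cproj m n p_char p_gt2 c_lt c_ge) // in zE.
  rewrite mulmx0 oppr0 addr0 in zE.
  have -> : q *m D = u *m e1 + z *m e2.
    apply: row_baseI; rewrite -mulmxA DE mulmxA -[q *m iQ]hsubmxK dmxE -/u.
    rewrite mulmxDl -(mulmxA u) -(mulmxA z) e1E e2E !mul_mx_row !mulmx0.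
    rewrite add_row_mx addr0 add0r.
    rewrite (mulmx_avg p_char p_gt2 hp le_pd c_lt) // mulmxA -zE.
    by rewrite (mulmx_avg p_char p_gt2 hp le_pd c_lt).
  have killv v e : is_shom natrep Qrep e ->
      (v : 'rV_N) *m e *m K *m iQ *m pr2 *m cproj = 0.
    by move/kill/(congr1 (mulmx v)); rewrite mulmx0 !mulmxA.
  by rewrite !mulmxDl !killv ?addr0.
have allz (q : 'rV_(\rank Qspace)) : q *m iQ *m pr2 *m cproj = 0.
  (* [q - q *m D *m K] lies in ker D = im D, and second components of im D lie in the image of Y,
     which [cproj] kills. *)
  have : (q - q *m D *m K) *m D = 0.
    by rewrite mulmxBl -!mulmxA (mulmxA D) -DKD subrr.
  move/sub_kermxP/submx_trans/(_ kerD)/submxP=> [r /eqP].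
  rewrite subr_eq => /eqP ->; rewrite !mulmxDl DKpr addr0.
  have -> : r *m D *m iQ *m pr2 *m cproj = r *m (iQ *m (dmx *m pr2 *m cproj)).
    by rewrite -(mulmxA r D) DE !mulmxA.
  have -> : dmx *m pr2 *m cproj = 0; last by rewrite !mulmx0.
  rewrite /dmx /pr2 mul_block_col !mulmx0 !add0r !mulmx1 mul_col_mx !mulNmx.
  by rewrite -mulmxA (ymx_cproj m n p_char p_gt2 c_lt c_ge) // mulmx0 oppr0 col_mx0.
pose x := sym_word false.
have cx : constant_word p x.
  by apply/constant_wordP => i j ip jp; rewrite !ffunE ip jp.
have xZ : (ev x <= Zinv)%MS.
  apply: submx_trans (sym_semiinv_sub false); apply: ev_sub_semiinv.
  exact: stab_sym_word.
have /submxP[q qE] : (row_mx 0 (ev x) <= iQ)%MS.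
  by rewrite eq_row_base; apply/QspaceP; rewrite sub0mx.
have := allz q; rewrite -qE mul_row_col mulmx0 mulmx1 add0r ev_cproj cx scale1r.
move/(congr1 (fun w => crd w x)); rewrite crd_ev eqxx /crd mxE.
by apply/eqP/oner_neq0.
Qed.

(** The single module im D serves for every [len], since a projective resolution of any finite
    length would split [D]. *)
Lemma gldim_infinite : schur_gldim_infinite F m n d.
Proof.
move=> len; have [D HD [DE exD]] := Qrep_differential.
exists (\rank D), (subrep Qrep D); split.
  apply: subrep_smodule Qrep_smodule _ => A SA.
  by rewrite -HD // submxMl.
move=> pd.
have [K HK DKD] := pd_le_split Qrep_smodule Qrep_sproj HD exD pd.
exact: (Qrep_nonsplit HD HK DE exD DKD).
Qed.

End PeriodicResolution.

Theorem theorem5p1p1 (F : closedFieldType) (p d m n : nat) :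
  p \in [pchar F]%R -> (5 <= p)%N -> (p <= d)%N -> (d <= m)%N -> (d <= n)%N ->
  schur_gldim_infinite F m n d.
Proof.
move=> p_char p_ge5 le_pd le_dm le_dn.
have p_pr := pcharf_prime p_char.
have odd_p : odd p by case: (even_prime p_pr) => // p2; move: p_ge5; rewrite p2.
have hp : (p.-1)./2.*2 = p.-1 by lia.
have p_gt2 : (2 < p)%N by lia.
have p_gt0 : (0 < p)%N by lia.
have lt_f (i : 'I_d) : (i.+1 %% p < d)%N.
  by apply: leq_trans le_pd; rewrite ltn_pmod //; lia.
(* The cycle sending i to i+1 modulo p on the first p places and fixing the others. *)
pose f (i : 'I_d) := if (i < p)%N then Ordinal (lt_f i) else i.
have f_inj : injective f.
  move=> i j; rewrite /f.
  have mod_p k : (k < p)%N -> (k.+1 %% p = if k.+1 == p then 0 else k.+1)%N.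
    by move=> kp; case: eqP => [->|ne]; rewrite ?modnn ?modn_small //; lia.
  case: ifP => ip; case: ifP => jp // /(congr1 val) /= e; apply/val_inj => /=.
  - by move: e; rewrite !mod_p //; do 2?case: eqP; lia.
  - by have := ltn_pmod i.+1 p_gt0; rewrite e jp.
  - by have := ltn_pmod j.+1 p_gt0; rewrite -e ip.
have c_lt (i : 'I_d) : (i < p)%N -> perm f_inj i = (i.+1 %% p)%N :> nat.
  by move=> ip; rewrite permE /f ip.
have c_ge (i : 'I_d) : (p <= i)%N -> perm f_inj i = i.
  by move=> ip; rewrite permE /f ltnNge ip.
exact: (gldim_infinite p_char p_gt2 hp le_pd le_dm le_dn c_lt c_ge).
Qed.
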